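(* Let $(c_{ih},p_{ih},\psi_h)$, $i=1,\dots,m$, be the solution of the semi-discrete DG scheme described in the context. 1. The semi-discrete scheme is conservative in the sense that each total concentration $c_{ih}$ ($i=1,\dots,m$) remains unchanged in time: $$\frac{d}{dt}\sum_{j=1}^N\int_{I_j}c_{ih}(t,x)\,dx=0,\qquad t>0.$$ 2. Suppose that $\partial_t\sigma=0$ and $c_{ih}(t,x)>0$ in each $I_j$. Then the semi-discrete free energy $$F=\sum_{j=1}^N\int_{I_j}\Big[\sum_{i=1}^mc_{ih}\log c_{ih}+\frac12\Big(\sum_{i=1}^mq_ic_{ih}+\rho_0\Big)\psi_h\Big]dx+\frac12\int_{\partial\Omega}\sigma\psi_h\,ds$$ satisfies $$\frac{d}{dt}F=-\sum_{i=1}^mA_{c_{ih}}(p_{ih},p_{ih}).$$ Moreover, $$\frac{d}{dt}F\le0,$$ provided $\beta_0$ is suitably large, and $\beta_1=0$ in the flux $Fl(\psi_h)$.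
   Context: Mesh and space: $\Omega=[a,b]$ is partitioned by a mesh, not necessarily uniform, into $N$ cells $I_j=(x_{j-1/2},x_{j+1/2})$ with $a=x_{1/2}<x_{3/2}<\dots<x_{N+1/2}=b$; $h$ denotes the characteristic mesh length. $V_h=\{v\in L^2(\Omega): v|_{I_j}\in P^k(I_j),\ j=1,\dots,N\}$, $P^k$ being the polynomials of degree at most $k$. Data: charges $q_1,\dots,q_m$; a fixed charge $\rho_0(x)$; Neumann data $\sigma$ for the potential, with values $\sigma_a,\sigma_b$ of $\partial_x\psi$ at $a,b$, and the convention $\int_{\partial\Omega}\sigma\eta\,ds=\sigma_b\,\eta(b^-)-\sigma_a\,\eta(a^+)$. The initial data $c_{ih}(0,\cdot)$ are the $L^2$ projections onto $V_h$ of given initial concentrations $c_i^{\rm in}$ that satisfy the compatibility condition $\int_\Omega(\sum_{i=1}^mq_ic_i^{\rm in}+\rho_0)\,dx+\int_{\partial\Omega}\sigma\,ds=0$. Fluxes: at an interior interface, $q^\pm$ are the right/left limits of $q$, $[q]=q^+-q^-$, $\{q\}=(q^++q^-)/2$. With parameters $\beta_0,\beta_1$, which may be chosen differently for $p_{ih}$ and for $\psi_h$, $$Fl(w)=\beta_0\frac{[w]}{h}+\{\partial_xw\}+\beta_1h[\partial_x^2w].$$ $(\cdot)|_{\partial I_j}$ is the value at $x_{j+1/2}$ minus the value at $x_{j-1/2}$, un-averaged functions being evaluated by limits from inside $I_j$. Semi-discrete DG scheme: find $c_{ih},p_{ih},\psi_h\in V_h$ such that for all $v_i,r_i,\eta\in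 V_h$, all $j=1,\dots,N$, all $i=1,\dots,m$, $$\int_{I_j}\partial_tc_{ih}v_i\,dx=-\int_{I_j}c_{ih}\partial_xp_{ih}\partial_xv_i\,dx+\{c_{ih}\}\big(\widehat{\partial_xp_{ih}}v_i+(p_{ih}-\{p_{ih}\})\partial_xv_i\big)\big|_{\partial I_j},$$ $$\int_{I_j}p_{ih}r_i\,dx=\int_{I_j}(q_i\psi_h+\log c_{ih})r_i\,dx,$$ $$\int_{I_j}\partial_x\psi_h\partial_x\eta\,dx-\big(\widehat{\partial_x\psi_h}\eta+(\psi_h-\{\psi_h\})\partial_x\eta\big)\big|_{\partial I_j}=\int_{I_j}\Big(\sum_{i=1}^mq_ic_{ih}+\rho_0\Big)\eta\,dx,$$ where at interior interfaces $\widehat{\partial_xp_{ih}}=Fl(p_{ih})$, $\widehat{\partial_x\psi_h}=Fl(\psi_h)$, and at the boundary points $a,b$: $\widehat{\partial_xp_{ih}}=0$, $\{p_{ih}\}=p_{ih}$, $\{c_{ih}\}=c_{ih}$, $\{\psi_h\}=\psi_h$, and $\widehat{\partial_x\psi_h}=\sigma$ (i.e. $\sigma_a$ at $a$, $\sigma_b$ at $b$). For a positive function $M$, $$A_M(u,v)=\sum_{j=1}^N\int_{I_j}M\,\partial_xu\,\partial_xv\,dx+\sum_{j=1}^{N-1}\Big(\{M\}\big(Fl(u)[v]+\{\partial_xv\}[u]\big)\Big)_{j+1/2},$$ where in $A_{c_{ih}}(p_{ih},p_{ih})$ the flux $Fl$ has the parameters used for $p_{ih}$.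
   Formalization: The condition β₁=0 in Fl(ψ_h) is assumed for the energy identity too, since without it the identity is false in general (the form for ψ_h is not symmetric); ''β₀ suitably large'' means above a threshold depending on the mesh, h, k, β₁ of p_ih and bounds on the cell masses of c_ih. *)

(* Defs.v *)
From HB Require Import structures.
From mathcomp Require Import all_boot all_order all_algebra.
From mathcomp Require Import all_classical all_reals all_analysis.

Set Implicit Arguments.
Unset Strict Implicit.
Unset Printing Implicit Defensive.

Import Order.TTheory GRing.Theory Num.Theory.
Import numFieldNormedType.Exports.

Local Open Scope classical_set_scope.
Local Open Scope ring_scope.

(* Cells are numbered 0, ..., N-1 and nodes 0, ..., N: cell j is
   ]node j, node j.+1[, and the interior interfaces are the nodes e with
   0 < e < N. Values of [node] beyond N are irrelevant. The characteristic
   length [hlen] is any positive number, so that the maximal, minimal and mean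
   cell sizes are all instances. *)
Record mesh (R : realType) (a b : R) (N : nat) := Mesh {
  node : nat -> R ;
  hlen : R ;
  node_first : node 0 = a ;
  node_last : node N = b ;
  node_incr : forall j, (j < N)%N -> node j < node j.+1 ;
  hlen_gt0 : 0 < hlen
}.

Definition cell (R : realType) (a b : R) N (K : mesh a b N) (j : nat) : set R :=
  `]node K j, node K j.+1[.

Definition cellint (R : realType) (a b : R) N (K : mesh a b N) (j : nat)
    (f : R -> R) : R :=
  \int[@lebesgue_measure R]_(x in cell K j) f x.

(* A piecewise polynomial: v j is its polynomial on cell j, and only j < N
   matters. One-sided limits at the nodes are evaluations of the polynomial of
   the adjacent cell. *)
Definition pwpoly (R : realType) := nat -> {poly R}.

Definition Vh (R : realType) (N k : nat) : set (pwpoly R) :=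
  [set v | forall j, (j < N)%N -> (size (v j) <= k.+1)%N].

Definition pwderiv (R : realType) (v : pwpoly R) : pwpoly R :=
  fun j => (v j)^`().

Section Traces.
Context (R : realType) (a b : R) (N : nat) (K : mesh a b N).
Implicit Types (v w c : pwpoly R) (e : nat).

Definition left_lim v e : R := (v e.-1).[node K e].
Definition right_lim v e : R := (v e).[node K e].

Definition jump v e : R := right_lim v e - left_lim v e.

Definition avg v e : R :=
  if e == 0%N then right_lim v e
  else if e == N then left_lim v e
  else (right_lim v e + left_lim v e) / 2.

End Traces.

Record fluxpar (R : realType) := FluxPar { beta0 : R ; beta1 : R }.

Section Scheme.
Context (R : realType) (a b : R) (N : nat) (K : mesh a b N).
Implicit Types (u v w c M : pwpoly R) (e j : nat) (B : fluxpar R).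

Definition Fl B w e : R :=
  beta0 B * (jump K w e / hlen K) + avg K (pwderiv w) e
  + beta1 B * hlen K * jump K (pwderiv (pwderiv w)) e.

(* Numerical flux at every node, with prescribed values ga at a and gb at b. *)
Definition flux B (ga gb : R) w e : R :=
  if e == 0%N then ga else if e == N then gb else Fl B w e.

Definition on_bdry j (g : nat -> R) : R := g j.+1 - g j.

Definition A_form B M u v : R :=
  \sum_(0 <= j < N)
     cellint K j (fun x => (M j).[x] * (pwderiv u j).[x] * (pwderiv v j).[x])
  + \sum_(1 <= e < N)
     avg K M e * (Fl B u e * jump K v e + avg K (pwderiv v) e * jump K u e).

End Scheme.

Record pnp_data (R : realType) (m : nat) := PNPData {
  charge : 'I_m -> R ;
  rho0 : R -> R ;
  sigma_a : R -> R ;           (* sigma_a, sigma_b are functions of time *)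
  sigma_b : R -> R ;
  cinit : 'I_m -> R -> R
}.

Definition square_integrable (R : realType) (D : set R) (f : R -> R) : Prop :=
  measurable_fun D f /\
  (@lebesgue_measure R).-integrable D (fun x => (f x ^+ 2)%:E).

Definition admissible_data (R : realType) (a b : R) (m : nat)
    (P : pnp_data R m) : Prop :=
  [/\ (@lebesgue_measure R).-integrable `[a, b] (fun x => (rho0 P x)%:E),
      forall i, square_integrable `[a, b] (cinit P i) &
      \int[@lebesgue_measure R]_(x in `[a, b])
         (\sum_(i < m) charge P i * cinit P i x + rho0 P x)
      + (sigma_b P 0 - sigma_a P 0) = 0].

Definition is_L2_projection (R : realType) (a b : R) N (K : mesh a b N)
    (k : nat) (f : R -> R) (w : pwpoly R) : Prop :=
  w \in Vh N k /\
  forall v, v \in Vh N k -> forall j, (j < N)%N ->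
    cellint K j (fun x => (w j).[x] * (v j).[x])
    = cellint K j (fun x => f x * (v j).[x]).

(* Time derivative, at time t and at the point x of cell j, of a piecewise
   polynomial depending on time. *)
Definition dt (R : realType) (u : R -> pwpoly R) (t : R) (j : nat) (x : R) : R :=
  'D_1 (fun s : R => (u s j).[x]) t.

(* Total charge density sum_i q_i c_i + rho_0 at the point x of cell j. *)
Definition chargedens (R : realType) (m : nat) (P : pnp_data R m)
    (c : 'I_m -> R -> pwpoly R) (t : R) (j : nat) (x : R) : R :=
  \sum_(i < m) charge P i * (c i t j).[x] + rho0 P x.

Section Solution.
Context (R : realType) (a b : R) (N : nat) (K : mesh a b N) (k m : nat).
Context (P : pnp_data R m) (Bp Bpsi : fluxpar R).
Context (c p : 'I_m -> R -> pwpoly R) (psi : R -> pwpoly R).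

Definition scheme_c (t : R) : Prop :=
  forall (i : 'I_m) (v : pwpoly R), v \in Vh N k ->
  forall j, (j < N)%N ->
    cellint K j (fun x => dt (c i) t j x * (v j).[x])
    = - cellint K j (fun x =>
          (c i t j).[x] * (pwderiv (p i t) j).[x] * (pwderiv v j).[x])
      + on_bdry j (fun e =>
          avg K (c i t) e *
          (flux K Bp 0 0 (p i t) e * (v j).[node K e]
           + ((p i t j).[node K e] - avg K (p i t) e)
             * (pwderiv v j).[node K e])).

Definition scheme_p (t : R) : Prop :=
  forall (i : 'I_m) (r : pwpoly R), r \in Vh N k ->
  forall j, (j < N)%N ->
    cellint K j (fun x => (p i t j).[x] * (r j).[x])
    = cellint K j (fun x =>
        (charge P i * (psi t j).[x] + ln (c i t j).[x]) * (r j).[x]).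

Definition scheme_psi (t : R) : Prop :=
  forall (eta : pwpoly R), eta \in Vh N k ->
  forall j, (j < N)%N ->
    cellint K j (fun x => (pwderiv (psi t) j).[x] * (pwderiv eta j).[x])
    - on_bdry j (fun e =>
        flux K Bpsi (sigma_a P t) (sigma_b P t) (psi t) e * (eta j).[node K e]
        + ((psi t j).[node K e] - avg K (psi t) e)
          * (pwderiv eta j).[node K e])
    = cellint K j (fun x => chargedens P c t j x * (eta j).[x]).

(* A solution on the time interval ]0, T[, T = +oo allowed. The concentrations
   are differentiable in time and continuous at t = 0; the algebraic unknowns
   p and psi are only required to be continuous in time. *)
Record dg_solution (T : \bar R) : Prop := DGSolution {
  sol_Vh : forall t, 0 < t -> (t%:E < T)%E ->
    [/\ forall i, c i t \in Vh N k, forall i, p i t \in Vh N k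
      & psi t \in Vh N k] ;
  sol_c_derivable : forall t, 0 < t -> (t%:E < T)%E ->
    forall i j x, (j < N)%N -> derivable (fun s : R => (c i s j).[x]) t 1 ;
  sol_p_continuous : forall t, 0 < t -> (t%:E < T)%E ->
    forall i j x, (j < N)%N -> {for t, continuous (fun s : R => (p i s j).[x])} ;
  sol_psi_continuous : forall t, 0 < t -> (t%:E < T)%E ->
    forall j x, (j < N)%N -> {for t, continuous (fun s : R => (psi s j).[x])} ;
  sol_initial : forall i, is_L2_projection K k (cinit P i) (c i 0) ;
  sol_c_at0 : forall i j x, (j < N)%N ->
    (fun s : R => (c i s j).[x]) @ 0^'+ --> (c i 0 j).[x] ;
  sol_scheme : forall t, 0 < t -> (t%:E < T)%E ->
    [/\ scheme_c t, scheme_p t & scheme_psi t]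
}.

Definition positive_conc (T : \bar R) : Prop :=
  forall t, 0 < t -> (t%:E < T)%E ->
  forall i j x, (j < N)%N -> x \in cell K j -> 0 < (c i t j).[x].

Definition stationary_sigma (T : \bar R) : Prop :=
  forall t : R, 0 < t -> (t%:E < T)%E ->
    is_derive t 1 (sigma_a P) 0 /\ is_derive t 1 (sigma_b P) 0.

Definition total_conc (i : 'I_m) (t : R) : R :=
  \sum_(0 <= j < N) cellint K j (fun x => (c i t j).[x]).

Definition free_energy (t : R) : R :=
  \sum_(0 <= j < N) cellint K j (fun x =>
     \sum_(i < m) (c i t j).[x] * ln (c i t j).[x]
     + 2^-1 * chargedens P c t j x * (psi t j).[x])
  + 2^-1 * (sigma_b P t * left_lim K (psi t) N
            - sigma_a P t * right_lim K (psi t) 0).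

End Solution.

(* Main.v *)
(* Testing the concentration equation with [1] and with [p_i] turns the sum over
   cells of the numerical fluxes into jump terms at the interior interfaces; this
   gives conservation, and reduces the energy identity to computing the time
   derivative of the free energy as the sum of the integrals of
   [dt c_i * (p_i + 1)].

   The unknowns [p_i] and [psi] are only continuous in time and [c_i] may vanish
   at the nodes, so neither half of the energy is differentiated under the
   integral. When [beta1 = 0] the form of the Poisson equation is symmetric, and
   the increment of the electrostatic energy becomes a pairing of increments of
   the charge with [psi s + psi t]. For the entropy, convexity of [x ln x] squeezes
   the increment between integrals of [(c s - c t) * (ln c + 1)], in which the
   logarithm may be replaced by its projection.

   Dissipation: a polynomial of degree at most [k] is comparable to its value at
   any given point on most pieces of a fine subdivision of the cell, hence the
   weighted integral of [c * p' ^ 2] controls the traces of [p'] and [p''], and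
   AM-GM absorbs the jump terms once [beta0] is large. *)
Require Import Defs.
From mathcomp Require Import all_boot all_order all_algebra.
From mathcomp Require Import all_classical all_reals all_analysis.
From mathcomp Require Import measurable_realfun qpoly ring lra.
Import Order.TTheory GRing.Theory Num.Theory.
Import numFieldNormedType.Exports.
Local Open Scope classical_set_scope.
Local Open Scope ring_scope.

Set Implicit Arguments.
Unset Strict Implicit.
Unset Printing Implicit Defensive.

Local Notation integrable_oo al be f :=
  ((@lebesgue_measure _).-integrable `]al, be[ (EFin \o f)).
Local Notation integral_oo al be f :=
  (Rintegral (@lebesgue_measure _) `]al, be[ f).

(** * Integrals over an open interval *)

Lemma horner_integrable (R : realType) (al be : R) (p : {poly R}) :
  integrable_oo al be (horner p).
Proof.
have h : (@lebesgue_measure R).-integrable `[al, be] (EFin \o horner p).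
  apply: continuous_compact_integrable; first exact: segment_compact.
  by apply: continuous_subspaceT => x; exact: continuous_horner.
by apply: (integrableS _ _ _ h) => //; exact: subset_itv_oo_cc.
Qed.

Lemma integrable_mul_horner (R : realType) (al be : R) (f : R -> R)
    (p : {poly R}) :
  integrable_oo al be f -> integrable_oo al be (fun x => f x * p.[x]).
Proof.
move=> fi.
have mp : measurable_fun `]al, be[ (horner p).
  apply: measurable_funTS; apply: continuous_measurable_fun.
  exact: continuous_horner.
have bp : [bounded horner p x | x in `]al, be[].
  have /compact_bounded[M [Mr MP]] : compact (horner p @` `[al, be]).
    apply: continuous_compact; last exact: segment_compact.
    by apply: continuous_subspaceT => x; exact: continuous_horner.
  exists M; split=> // x Mx y /= yab; apply: MP => //.
  by exists y => //; exact: subset_itv_oo_cc.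
exact: (integrableMl _ fi mp bp).
Qed.

(** By monotone convergence along compact subintervals exhausting the open interval: on each of them
    the integral is an increment of [G], at most [2M]. This handles integrands that blow up at the
    endpoints. *)
Lemma integrable_of_bounded_primitive (R : realType) (al be M : R)
    (g G : R -> R) : 
  (forall x, al < x < be -> 0 <= g x) ->
  (forall x, al < x < be -> {for x, continuous g}) ->
  (forall x, al < x < be -> is_derive x 1 G (g x)) ->
  (forall x, al < x < be -> `|G x| <= M) ->
  integrable_oo al be g.
Proof.
move=> g0 gc Gg GM.
have [ab|ba] := ltP al be; last first.
  rewrite set_itv_ge; first exact: integrable_set0.
  by rewrite bnd_simp -leNgt.
pose F (n : nat) : set R := `[al + n.+1%:R^-1, be - n.+1%:R^-1]%classic.
have Fsub n x : F n x -> al < x < be.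
  rewrite /F /= in_itv/= => /andP[x1 x2].
  rewrite (lt_le_trans _ x1) ?ltrDl ?invr_gt0 ?ltr0n//=.
  by rewrite (le_lt_trans x2)// ltrBlDr ltrDl invr_gt0 ltr0n.
have ndF : nondecreasing_seq F.
  move=> m n mn; rewrite subsetEset => x; rewrite /F /= !in_itv/= => /andP[x1 x2].
  have inv : (n.+1%:R : R)^-1 <= m.+1%:R^-1.
    by rewrite lef_pV2 ?posrE ?ltr0n// ler_nat ltnS.
  apply/andP; split.
    by rewrite (le_trans _ x1)// lerD2l.
  by rewrite (le_trans x2)// lerD2l lerN2.
have mg : measurable_fun `]al, be[ g.
  apply: open_continuous_measurable_fun; first exact: interval_open.
  by move=> x; rewrite inE/= in_itv/= => /gc.
have UF : \bigcup_n F n = `]al, be[%classic.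
  apply/seteqP; split=> x /=.
    by move=> [n _ /Fsub]; rewrite in_itv.
  rewrite in_itv/= => /andP[x1 x2].
  pose e := Num.min (x - al) (be - x).
  have e0 : 0 < e by rewrite lt_min !subr_gt0 x1.
  have [n _ nP] := near_infty_natSinv_lt (PosNum e0).
  have := nP n (leqnn n); rewrite /= lt_min => /andP[n1 n2].
  exists n => //; rewrite /F /= in_itv/=; move: n1 n2.
  set i := _^-1 => n1 n2; apply/andP; split.
    by rewrite -lerBrDl ltW.
  by rewrite lerBrDl -lerBrDr ltW.
apply/integrableP; split; first exact/measurable_EFinP.
have -> : (\int[@lebesgue_measure R]_(x in `]al, be[) `|(EFin \o g) x| =
           \int[@lebesgue_measure R]_(x in `]al, be[) (EFin \o g) x)%E.
  apply: eq_integral => x; rewrite inE/= in_itv/= => /g0 gx.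
  by rewrite ger0_norm.
have mFn i : measurable_fun (F i) (EFin \o g).
  apply/measurable_EFinP; apply: measurable_funS mg => //.
  by move=> x /Fsub; rewrite /= in_itv.
have cv := @ge0_nondecreasing_set_cvg_integral _ (measurableTypeR R) R F (EFin \o g)
   (@lebesgue_measure R) ndF (fun i => measurable_itv _) mFn.
have {}cv : (\int[@lebesgue_measure R]_(x in F i) (EFin \o g) x @[i --> \oo]
    --> \int[@lebesgue_measure R]_(x in `]al, be[) (EFin \o g) x)%E.
  by rewrite -UF; apply: cv => i x /Fsub /g0; rewrite /= lee_fin.
apply: (@le_lt_trans _ _ (`|M + M|)%:E); last exact: ltry.
rewrite -(cvg_lim _ cv)//; apply: lime_le; first by apply/cvg_ex; eexists; exact: cv.
near=> n.
rewrite /F; set y := al + _; set z := be - _.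
(* For small [n] the subinterval may be empty or a single point, where the integral vanishes. *)
have [yz|zy] := ltP y z; last first.
  have [yz|yz] := eqVneq y z.
    by rewrite yz set_itv1 integral_set1 lee_fin.
  rewrite set_itv_ge ?integral_set0 ?lee_fin//.
  by rewrite bnd_simp -ltNge lt_neqAle eq_sym yz.
have inn x : y <= x <= z -> al < x < be.
  by move=> xyz; apply: (@Fsub n); rewrite /F /= in_itv.
rewrite (@continuous_FTC2 _ g G y z yz).
- rewrite -EFinB lee_fin (le_trans (ler_norm _))//.
  rewrite (le_trans (ler_normB _ _))// (le_trans _ (ler_norm _))//.
  by rewrite lerD// GM// inn// lexx ltW.
- apply: continuous_in_subspaceT => x; rewrite inE/= in_itv/= => /inn.
  exact: gc.
- have cG x : al < x < be -> {for x, continuous G}.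
    move=> /Gg H; apply: differentiable_continuous.
    by apply/derivable1_diffP; exact: ex_derive.
  split.
  + move=> x; rewrite in_itv/= => /andP[x1 x2].
    have /Gg H : al < x < be by apply: inn; rewrite !ltW.
    exact: ex_derive.
  + apply: cvg_at_right_filter; apply: cG; apply: inn.
    by rewrite lexx ltW.
  + apply: cvg_at_left_filter; apply: cG; apply: inn.
    by rewrite lexx ltW.
- move=> x; rewrite in_itv/= => /andP[x1 x2].
  have /Gg H : al < x < be by apply: inn; rewrite !ltW.
  by rewrite derive1E; exact: derive_val.
Unshelve. all: by end_near. Qed.

Lemma integrable_ooB (R : realType) (al be : R) (f g : R -> R) :
  integrable_oo al be f -> integrable_oo al be g ->
  integrable_oo al be (fun x => f x - g x).
Proof. by move=> fi gi; exact: (integrableB _ fi gi). Qed.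

Lemma integrable_ooD (R : realType) (al be : R) (f g : R -> R) :
  integrable_oo al be f -> integrable_oo al be g ->
  integrable_oo al be (fun x => f x + g x).
Proof. by move=> fi gi; exact: (integrableD _ fi gi). Qed.

Lemma eq_integrable_oo (R : realType) (al be : R) (f g : R -> R) :
  (forall x, al < x < be -> f x = g x) ->
  integrable_oo al be f -> integrable_oo al be g.
Proof.
move=> fg; apply: eq_integrable => // x.
by rewrite inE/= in_itv/= => /fg ->.
Qed.

Lemma integrable_oo_cst (R : realType) (al be k : R) :
  integrable_oo al be (fun=> k).
Proof.
have := @horner_integrable R al be k%:P.
by apply: eq_integrable_oo => x _; rewrite hornerC.
Qed.

(** The sign [s] treats a point [y] to the left and to the right of the interval at once. With
    [u = s (x - y)] and [L] above [u], the function [ln L - ln u] is nonnegative and has the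
    primitive [s (u (ln L - ln u) + u)], which the inequality [ln z <= z - 1] at [z = L / u] bounds
    by [L]. *)
Lemma integrable_ln_dist (R : realType) (al be s y : R) : s ^+ 2 = 1 ->
  (forall x, al < x < be -> 0 < s * (x - y)) ->
  integrable_oo al be (fun x => ln (s * (x - y))).
Proof.
move=> s1 u0.
pose L : R := `|al| + `|be| + `|y| + 1.
have s_norm : `|s| = 1.
  by apply/eqP; rewrite -(@eqrXn2 _ 2)// real_normK ?num_real// s1 expr1n.
have L0 : 0 < L by rewrite ltr_wpDl// !addr_ge0.
have uL x : al < x < be -> s * (x - y) < L.
  move=> /andP[ax xb]; apply: (le_lt_trans (ler_norm _)).
  rewrite normrM s_norm mul1r /L.
  have := ler_norm al; have := ler_norm (- al); have := ler_norm be.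
  have := ler_norm (- be); have := ler_norm y; have := ler_norm (- y).
  rewrite !normrN.
  by case: (ger0P (x - y)) => _ ? ? ? ? ? ?; lra.
pose u x := s * (x - y).
have du (x : R) : is_derive x 1 u s.
  have h : is_derive x 1 (cst s * (id - cst y) : R -> R) s.
    by apply: is_derive_eq; rewrite /GRing.scale/= !fctE; ring.
  exact: h.
have dln x : al < x < be -> is_derive x 1 (@ln R \o u) ((u x)^-1 * s).
  by move=> /u0 ux; exact: (is_derive1_comp (is_derive1_ln _) _).
pose G x := s * (u x * (ln L - ln (u x)) + u x).
have gG : integrable_oo al be (fun x => ln L - ln (u x)).
  have g0 x : al < x < be -> 0 <= ln L - ln (u x).
    by move=> abx; rewrite subr_ge0 ler_ln ?posrE// ?u0// ltW// uL.
  have H := @integrable_of_bounded_primitive R al be L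
    (fun x => ln L - ln (u x)) G g0.
  apply: H => x abx.
  - apply: differentiable_continuous; apply/derivable1_diffP.
    have := dln _ abx => h.
    have h1 : is_derive x 1 (cst (ln L) - (@ln R \o u) : R -> R)
        (0 - ((u x)^-1 * s)).
      exact: is_deriveB.
    exact: (@ex_derive _ _ _ _ _ _ _ h1).
  - have ux := u0 _ abx; have h := dln _ abx.
    have hG : is_derive x 1
        (cst s * (u * (cst (ln L) - (@ln R \o u)) + u) : R -> R)
        (ln L - ln (u x)).
      apply: is_derive_eq; rewrite /GRing.scale/= !fctE /=.
      rewrite -[RHS]mul1r -s1; field.
      by rewrite gt_eqF.
    exact: hG.
  - have ux : 0 < u x := u0 _ abx.
    rewrite /G normrM s_norm mul1r ger0_norm; last first.
      by apply: addr_ge0; [apply: mulr_ge0; [exact: ltW|exact: g0]|exact: ltW].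
    have := @le_ln1Dx R (L / u x - 1).
    rewrite ltrBrDl addrN divr_gt0// => /(_ isT).
    rewrite addrC subrK ln_div ?posrE// => h.
    have := ler_wpM2l (ltW ux) h.
    rewrite [X in _ <= X -> _]mulrBr mulr1 mulrCA divff ?gt_eqF// mulr1.
    by rewrite lerBrDr.
apply: (@eq_integrable_oo _ _ _ (fun x => ln L - (ln L - ln (u x)))).
  by move=> x _; rewrite opprB addrC subrK.
by apply: integrable_ooB => //; exact: integrable_oo_cst.
Qed.

Lemma horner_ge0_itvcc (R : realType) (al be : R) (c : {poly R}) : al < be ->
  (forall x, al < x < be -> 0 <= c.[x]) ->
  forall x, al <= x <= be -> 0 <= c.[x].
Proof.
move=> ab c0 x /andP[]; rewrite le_eqVlt => /predU1P[<- _|ax].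
  have cv : horner c @ al^'+ --> c.[al].
    by apply: cvg_at_right_filter; exact: continuous_horner.
  apply: (cvgr_to_ge cv); near=> z; apply: c0.
  apply/andP; split; near: z; [exact: nbhs_right_gt|exact: nbhs_right_lt].
rewrite le_eqVlt => /predU1P[->|xb]; last by rewrite c0 ?ax.
have cv : horner c @ be^'- --> c.[be].
  by apply: cvg_at_left_filter; exact: continuous_horner.
apply: (cvgr_to_ge cv); near=> z; apply: c0.
apply/andP; split; near: z; [exact: nbhs_left_gt|exact: nbhs_left_lt].
Unshelve. all: by end_near. Qed.

(** Induction on the degree: a root at an endpoint is divided out and contributes the integrable
    logarithm of a distance. Once neither endpoint is a root, [c] is positive on the closed interval
    and its logarithm is continuous there. *)
Lemma integrable_ln_horner (R : realType) (al be : R) (c : {poly R}) :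
  (forall x, al < x < be -> 0 < c.[x]) ->
  integrable_oo al be (fun x => ln c.[x]).
Proof.
have [n] := ubnP (size c); elim: n c => // n IH c /ltnSE cn c0.
have [ab|ba] := ltP al be; last first.
  rewrite set_itv_ge; first exact: integrable_set0.
  by rewrite bnd_simp -leNgt.
have cne : c != 0.
  apply/eqP => cE.
  have := c0 ((al + be) / 2); rewrite cE horner0 ltxx => h.
  by suff : false by []; apply: h; apply/andP; split; lra.
have factor (s y : R) : s ^+ 2 = 1 -> root c y ->
    (forall x, al < x < be -> 0 < s * (x - y)) ->
    integrable_oo al be (fun x => ln c.[x]).
  move=> s1 /factor_theorem[q cq] sy.
  (* The sign goes into the quotient, so that both factors of [c] are positive and [ln] splits. *)
  pose d : {poly R} := s *: q.
  have cE x : c.[x] = d.[x] * (s * (x - y)).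
    rewrite cq hornerM hornerXsubC /d hornerZ mulrACA -[LHS]mul1r.
    by rewrite mulrA -mulrA -expr2 s1.
  have d0 x : al < x < be -> 0 < d.[x].
    by move=> abx; rewrite -(pmulr_lgt0 _ (sy _ abx)) -cE c0.
  apply: (@eq_integrable_oo _ _ _ (fun x => ln d.[x] + ln (s * (x - y)))).
    by move=> x abx; rewrite cE [RHS]lnM ?posrE ?(d0 _ abx) ?(sy _ abx).
  apply: integrable_ooD; last exact: integrable_ln_dist.
  apply: IH => //.
  have s0 : s != 0.
    by apply/eqP => s0; move/eqP: s1; rewrite s0 expr0n eq_sym oner_eq0.
  rewrite /d size_scale// (leq_trans _ cn)// cq size_Mmonic ?monicXsubC//.
    by rewrite size_XsubC addn2.
  by apply: contraNneq cne => q0; rewrite cq q0 mul0r.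
have [/factor|cal] := boolP (root c al).
  move=> /(_ 1); apply; first by rewrite expr1n.
  by move=> x /andP[xa _]; rewrite mul1r subr_gt0.
have [/factor|cbe] := boolP (root c be).
  move=> /(_ (-1)); apply; first by rewrite sqrrN expr1n.
  by move=> x /andP[_ xb]; rewrite mulN1r opprB subr_gt0.
have cc0 x : al <= x <= be -> 0 < c.[x].
  move=> axb; rewrite lt_neqAle (@horner_ge0_itvcc _ al be)// ?andbT; last first.
    by move=> y /c0/ltW.
  rewrite eq_sym; case/andP: axb.
  rewrite le_eqVlt => /predU1P[<-//|ax]; rewrite le_eqVlt => /predU1P[->//|xb].
  by rewrite gt_eqF// c0// ax.
have h : (@lebesgue_measure R).-integrable `[al, be] (EFin \o (fun x => ln c.[x])).
  apply: continuous_compact_integrable; first exact: segment_compact.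
  apply: continuous_in_subspaceT => x; rewrite inE/= in_itv/= => /cc0 cx.
  apply: (@continuous_comp _ _ _ (horner c) (@ln R)).
    exact: continuous_horner.
  exact: continuous_ln.
by apply: (integrableS _ _ _ h) => //; exact: subset_itv_oo_cc.
Qed.

(** * Weighted inverse inequalities for polynomials *)

(** Newton's divided differences: removing one node replaces [P] by a quotient of smaller degree,
    whose values at the other nodes are at most [2 e / d] because the nodes are [d] apart. The
    constant does not depend on where the nodes lie. *)
Lemma horner_bound_separated (R : realType) (al be d : R) (n : nat) : 0 < d ->
  al < be ->
  exists2 B : R, 0 < B &
  forall (I : eqType) (s : seq I) (X : I -> R) (P : {poly R}) (e y : R),
    size s = n -> uniq s -> (size P <= n)%N ->
    (forall i, i \in s -> al <= X i <= be) ->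
    (forall i j, i \in s -> j \in s -> i != j -> d <= `|X i - X j|) ->
    0 <= e -> (forall i, i \in s -> `|P.[X i]| <= e) ->
    al <= y <= be -> `|P.[y]| <= B * e.
Proof.
move=> d0 ab; elim: n => [|n [B B0 IH]].
  exists 1 => // I s X P e y _ _; rewrite leqn0 size_poly_eq0 => /eqP -> _ _ e0 _ _.
  by rewrite horner0 normr0 mul1r.
(* Read off from [P(y) = P(X i) + (y - X i) Q(y)], with [B * (2 / d * e)] bounding [Q(y)] by
   induction. *)
exists (1 + (be - al) * (B * (2 / d))).
  by rewrite ltr_pwDl// !mulr_ge0// ?invr_ge0 ?ltW// subr_gt0.
move=> I [//|i s] X P e y [sn] /= /andP[is_ us] Pn Xab Xd e0 Pe yab.
have /factor_theorem[Q PQ] : root (P - (P.[X i])%:P) (X i).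
  by rewrite /root !hornerE subrr.
have PE x : P.[x] = P.[X i] + (x - X i) * Q.[x].
  have /(congr1 (horner ^~ x)) := PQ.
  by rewrite /= !hornerE mulrC => <-; rewrite addrC subrK.
have Qn : (size Q <= n)%N.
  have [->|Q0] := eqVneq Q 0; first by rewrite size_poly0.
  have : (size (P - (P.[X i])%:P)%R <= n.+1)%N.
    by rewrite (leq_trans (size_polyD _ _))// size_polyN geq_max Pn
      (leq_trans (size_polyC_leq1 _)).
  by rewrite PQ size_Mmonic ?monicXsubC// size_XsubC addn2.
have Pi : `|P.[X i]| <= e by rewrite Pe// mem_head.
have Qe j : j \in s -> `|Q.[X j]| <= 2 / d * e.
  move=> js; have ij : j != i by apply: contraNneq is_ => <-.
  have dj : d <= `|X j - X i| by rewrite Xd// ?mem_head// in_cons js orbT.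
  have Xj0 : 0 < `|X j - X i| by rewrite (lt_le_trans d0).
  rewrite -(ler_pM2l Xj0) -normrM -[leLHS]/(`|_|).
  have -> : (X j - X i) * Q.[X j] = P.[X j] - P.[X i].
    by rewrite [P.[X j]]PE addrAC subrr add0r.
  rewrite (le_trans (ler_normB _ _))//.
  apply: (@le_trans _ _ (d * (2 / d * e))).
    rewrite mulrA mulrCA divff ?gt_eqF// mulr1 mulr2n mulrDl !mul1r lerD//.
    by rewrite Pe// in_cons js orbT.
  by rewrite ler_wpM2r// !mulr_ge0// invr_ge0 ltW.
have := IH I s X Q (2 / d * e) y sn us Qn.
have e2 : 0 <= 2 / d * e by rewrite !mulr_ge0// invr_ge0 ltW.
move=> /(_ _ _ e2 Qe yab) Qy.
have {}Qy : `|Q.[y]| <= B * (2 / d * e).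
  apply: Qy; first by move=> j js; apply: Xab; rewrite in_cons js orbT.
  by move=> j l js ls; apply: Xd; rewrite in_cons ?js ?ls orbT.
rewrite PE (le_trans (ler_normD _ _))// [leRHS]mulrDl mul1r lerD// normrM -!mulrA.
apply: ler_pM => //; last by move: Qy; rewrite -!mulrA.
have /andP[] : al <= X i <= be by rewrite Xab// mem_head.
by case/andP: yab => *; rewrite ler_norml; apply/andP; split; lra.
Qed.

(* Cut the interval into sufficiently many well separated pieces: a polynomial
   of bounded degree is comparable to [f.[y]] on all but a few of them, so one
   piece suits both [f] and [g]. *)
Lemma horner_common_lower_bound (R : realType) (al be : R) (n : nat) : al < be ->
  exists delta w : R, [/\ 0 < delta, 0 < w &
  forall (f g : {poly R}) (y z : R),
    (size f <= n.+1)%N -> (size g <= n.+1)%N ->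
    al <= y <= be -> al <= z <= be ->
    exists u : R, [/\ al <= u, u + w <= be &
      forall x, u <= x <= u + w ->
        delta * `|f.[y]| <= `|f.[x]| /\ delta * `|g.[z]| <= `|g.[x]|]].
Proof.
(* Each of [f] and [g] spoils at most [n] pieces, so some of the [M] pieces is good for both. *)
move=> ab; pose M := (n.+1 + n.+1)%N.
pose w := (be - al) / (M + M)%:R.
have MM0 : 0 < (M + M)%:R :> R by rewrite ltr0n.
have w0 : 0 < w by rewrite divr_gt0 ?subr_gt0.
have wE : (M + M)%:R * w = be - al by rewrite /w mulrC divfK// gt_eqF.
have [B B0 HB] := @horner_bound_separated R al be w n.+1 w0 ab.
(* Chosen so that [n.+1] bad pieces would give [|f(y)| <= |f(y)| / 2], while a bad piece forces
   [f(y)] to be nonzero. *)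
pose delta := (2 * B)^-1.
have delta0 : 0 < delta by rewrite invr_gt0 mulr_gt0.
(* Only every second of the [M + M] subintervals is kept: points of distinct pieces are then at
   least [w] apart. *)
pose u (l : 'I_M) := al + (l + l)%:R * w.
have ual l : al <= u l by rewrite lerDl mulr_ge0// ltW.
have ube l : u l + w <= be.
  rewrite /u -addrA -lerBrDl -wE -[X in _ + X]mul1r -mulrDl ler_pM2r//.
  by rewrite natr1 ler_nat -addSn leq_add// ltnW.
pose bad (f : {poly R}) (y : R) := [set l : 'I_M | `[< exists x : R,
   u l <= x <= u l + w /\ `|f.[x]| < delta * `|f.[y]| >]]%SET.
have badP (f : {poly R}) (y : R) : (size f <= n.+1)%N -> al <= y <= be ->
    (#|bad f y| <= n)%N.
  move=> fn yab; rewrite leqNgt; apply/negP => nb.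
  pose s := take n.+1 (enum (bad f y)).
  have ss : size s = n.+1 by rewrite size_takel// -cardE.
  have us : uniq s by rewrite take_uniq// enum_uniq.
  have sb l : l \in s -> l \in bad f y by move=> /mem_take; rewrite mem_enum.
  have [X XP] : exists X : 'I_M -> R, forall l, l \in bad f y ->
      u l <= X l <= u l + w /\ `|f.[X l]| < delta * `|f.[y]|.
    pose Q l : set R := [set x | u l <= x <= u l + w /\
      `|f.[x]| < delta * `|f.[y]|].
    exists (fun l => xget 0 (Q l)) => l; rewrite inE => /asboolP.
    exact: (@xgetPex _ 0 (Q l)).
  have fy0 : 0 < `|f.[y]|.
    have : (0 < size s)%N by rewrite ss.
    case: s sb {us ss} => // l s sb _.
    have [_ h] := XP l (sb _ (mem_head _ _)).
    by rewrite -(pmulr_rgt0 _ delta0) (le_lt_trans _ h).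
  have := HB _ s X f (delta * `|f.[y]|) y ss us fn.
  have -> : B * (delta * `|f.[y]|) = `|f.[y]| / 2.
    by rewrite /delta; field; rewrite gt_eqF.
  have half : `|f.[y]| / 2 < `|f.[y]| by rewrite ltr_pdivrMr// ltr_pMr// ltr1n.
  move=> H; suff : `|f.[y]| <= `|f.[y]| / 2 by rewrite leNgt half.
  apply: H => //.
  - move=> l /sb/XP[/andP[h1 h2] _].
    by rewrite (le_trans (ual l) h1) (le_trans h2).
  - move=> i j.
    have gap (i0 j0 : 'I_M) xi xj : (i0 < j0)%N -> xi <= u i0 + w ->
        u j0 <= xj -> w <= xj - xi.
      move=> ij hi hj.
      have : u i0 + w + w <= u j0.
        have -> : u i0 + w + w = al + (i0 + i0).+2%:R * w.
          by rewrite /u -2!natr1; ring.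
        by rewrite lerD2l ler_pM2r// ler_nat -addnS -addSn leq_add.
      by lra.
    move=> /sb/XP[/andP[i1 i2] _] /sb/XP[/andP[j1 j2] _].
    rewrite -val_eqE neq_ltn => /orP[ij|ji].
      by rewrite distrC (le_trans _ (ler_norm _))// (gap i j).
    by rewrite (le_trans _ (ler_norm _))// (gap j i).
  - by rewrite mulr_ge0// ltW.
  - by move=> l /sb/XP[_ /ltW].
exists delta, w; split=> // f g y z fn gn yab zab.
have [l lP] : exists l, l \notin (bad f y :|: bad g z)%SET.
  apply/existsP; rewrite -negb_forall; apply/negP => /forallP H.
  have : (#|'I_M| <= #|(bad f y :|: bad g z)%SET|)%N.
    by rewrite subset_leq_card//; apply/fintype.subsetP => l _; exact: H.
  rewrite card_ord leqNgt; apply/negP; rewrite negbK.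
  rewrite (leq_ltn_trans (leq_card_setU _ _))//.
  apply: (leq_ltn_trans (leq_add (badP _ _ fn yab) (badP _ _ gn zab))).
  by rewrite /M addSn ltnS leq_add.
exists (u l); split => // x xu.
move: lP; rewrite inE negb_or !inE => /andP[/asboolP f1 /asboolP g1].
split; rewrite leNgt; apply/negP => h; [apply: f1|apply: g1]; by exists x.
Qed.

Lemma lagrange_expansion (R : realType) (n : nat) (X : nat -> R) : injective X ->
  exists L : 'I_n.+1 -> {poly R}, (forall i, (size (L i) <= n.+1)%N) /\
    forall p : {poly R}, (size p <= n.+1)%N ->
      p = \sum_(i < n.+1) p.[X i] *: L i.
Proof.
move=> Xinj; exists (fun i => tnth (n.+1.-lagrange X) i); split.
  by move=> i; rewrite size_lagrange_.
move=> p pn; rewrite {1}(lagrange_gen (ltn0Sn n) Xinj pn).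
by apply: eq_bigr => i _; rewrite mul_polyC.
Qed.

(** By Lagrange interpolation [g'(z)] is a fixed linear combination of values of [g] in the
    interval. *)
Lemma deriv_horner_bound (R : realType) (al be z : R) (n : nat) : al < be ->
  exists2 C : R, 0 < C & forall (g : {poly R}) (e : R), (size g <= n.+1)%N ->
    (forall x, al <= x <= be -> `|g.[x]| <= e) -> `|g^`().[z]| <= C * e.
Proof.
move=> ab.
(* An injective sequence over all naturals that stays in the interval, as interpolation nodes. *)
pose X (l : nat) := al + (be - al) / l.+1%:R.
have bal : be - al != 0 by rewrite subr_eq0 gt_eqF.
have Xinj : injective X.
  move=> i j /addrI /(mulfI bal) /invr_inj /eqP.
  by rewrite eqr_nat => /eqP[].
have Xab l : al <= X l <= be.
  have b0 : 0 <= be - al by rewrite subr_ge0 ltW.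
  apply/andP; split; first by rewrite lerDl divr_ge0.
  by rewrite /X -lerBrDl ler_pdivrMr ?ltr0n// ler_peMr// ler1n.
have [L [_ LE]] := lagrange_expansion n Xinj.
exists (1 + \sum_(i < n.+1) `|(L i)^`().[z]|).
  by rewrite ltr_pwDl// sumr_ge0.
move=> g e gn ge.
have e0 : 0 <= e.
  by rewrite (le_trans _ (ge al _))// lexx ltW.
rewrite (LE _ gn) raddf_sum horner_sum (le_trans (ler_norm_sum _ _ _))//.
rewrite mulrDl mul1r ler_wpDl// mulr_suml ler_sum// => i _.
rewrite /= derivZ hornerZ normrM mulrC ler_wpM2l//.
exact: ge.
Qed.

Lemma integral_oo_subset (R : realType) (al be u v : R) (f : {poly R}) :
  al <= u -> v <= be -> (forall x, al < x < be -> 0 <= f.[x]) ->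
  integral_oo u v (fun x => f.[x]) <= integral_oo al be (fun x => f.[x]).
Proof.
move=> au vb f0.
have fi := horner_integrable al be f.
have gi := horner_integrable u v f.
apply: fine_le.
- exact: (integrable_fin_num _ gi).
- exact: (integrable_fin_num _ fi).
apply: ge0_subset_integral => //.
- by case/integrableP : fi.
- by apply: subset_itv; rewrite bnd_simp.
Qed.

Lemma integral_ooZl (R : realType) (al be r : R) (f : R -> R) :
  integrable_oo al be f ->
  integral_oo al be (fun x => r * f x) = r * integral_oo al be f.
Proof. by move=> fi; exact: RintegralZl. Qed.

Lemma integral_oo_cst (R : realType) (al be r : R) : al <= be ->
  integral_oo al be (fun=> r) = r * (be - al).
Proof.
move=> ab; rewrite Rintegral_cst//= lebesgue_measure_itv/= lte_fin.
have [_|ba] := ltP al be; first by rewrite -EFinD.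
by rewrite (le_anti (introT andP (conj ab ba))) subrr.
Qed.

(** The integrand is nonnegative, so it may be integrated over the one piece where [f] and [g] are
    both comparable to the prescribed values. *)
Lemma integral_weighted_sqr_ge (R : realType) (al be : R) (n : nat) : al < be ->
  exists2 kappa : R, 0 < kappa & forall (f g : {poly R}) (y z : R),
    (size f <= n.+1)%N -> (size g <= n.+1)%N ->
    (forall x, al < x < be -> 0 <= f.[x]) ->
    al <= y <= be -> al <= z <= be ->
    kappa * f.[y] * g.[z] ^+ 2 <=
      integral_oo al be (fun x => f.[x] * g.[x] * g.[x]).
Proof.
move=> ab; have [d [w [d0 w0 H]]] := @horner_common_lower_bound R al be n ab.
(* One factor [d] comes from [f], two from the square of [g], and [w] is the length of the piece. *)
exists (d ^+ 3 * w); first by rewrite mulr_gt0// exprn_gt0.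
move=> f g y z fn gn f0 yab zab.
have {}f0 := horner_ge0_itvcc ab f0.
have [u [au ub {}H]] := H f g y z fn gn yab zab.
have FE (x : R) : f.[x] * g.[x] * g.[x] = (f * g * g).[x] by rewrite !hornerM.
have sq0 x : al <= x <= be -> 0 <= f.[x] * g.[x] * g.[x].
  by move=> xab; rewrite -mulrA -expr2 mulr_ge0 ?f0 ?sqr_ge0.
have -> : integral_oo al be (fun x => f.[x] * g.[x] * g.[x]) =
    integral_oo al be (fun x => (f * g * g).[x]).
  by apply: eq_Rintegral => x _.
apply: (@le_trans _ _ (integral_oo u (u + w) (fun x => (f * g * g).[x])));
  last first.
  apply: integral_oo_subset => // x /andP[x1 x2].
  by rewrite -FE sq0// !ltW.
set k := (X in X <= _).
have -> : k = integral_oo u (u + w) (fun=> (d * f.[y]) * (d * `|g.[z]|) ^+ 2).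
  rewrite integral_oo_cst ?lerDl ?ltW// exprMn real_normK ?num_real// /k; ring.
apply: le_Rintegral => //.
- exact: integrable_oo_cst.
- exact: horner_integrable.
move=> x /=; rewrite in_itv/= => /andP[x1 x2].
have [|fx gx] := H x; first by rewrite !ltW.
have xab : al <= x <= be.
  by rewrite (le_trans au (ltW x1)) (le_trans (ltW x2) ub).
rewrite -FE -[leRHS]mulrA -expr2.
have {}fx : d * f.[y] <= f.[x] by move: fx; rewrite !ger0_norm ?f0.
rewrite -[g.[x] ^+ 2]real_normK ?num_real//.
apply: ler_pM => //; [by rewrite mulr_ge0 ?f0// ltW|exact: sqr_ge0|].
by rewrite ler_sqr ?nnegrE// mulr_ge0// ltW.
Qed.

(** The weight may vanish at the endpoint [z], so the traces of [g] and of its derivative are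
    controlled through the mass [m] of the weight instead of [f.[z]]. *)
Lemma cell_trace_bounds (R : realType) (al be : R) (n : nat) : al < be ->
  exists2 kappa : R, 0 < kappa & forall (f g : {poly R}) (z : R),
    (size f <= n.+1)%N -> (size g <= n.+1)%N ->
    (forall x, al < x < be -> 0 <= f.[x]) -> z \in [:: al; be] ->
    let m := integral_oo al be (fun x => f.[x]) in
    let w := integral_oo al be (fun x => f.[x] * g.[x] * g.[x]) in
    [/\ kappa * f.[z] <= m, kappa * m * g.[z] ^+ 2 <= w
      & kappa * m * g^`().[z] ^+ 2 <= w].
Proof.
move=> ab.
have [K K0 HK] := @integral_weighted_sqr_ge R al be n ab.
have [C1 C10 HC1] := @deriv_horner_bound R al be al n ab.
have [C2 C20 HC2] := @deriv_horner_bound R al be be n ab.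
pose C := Num.max C1 C2.
have C0 : 0 < C by rewrite lt_max C10.
pose K1 := K / (be - al).
have K10 : 0 < K1 by rewrite divr_gt0 // subr_gt0.
pose K2 := K1 / C ^+ 2.
have K20 : 0 < K2 by rewrite divr_gt0 // exprn_gt0.
exists (Num.min K (Num.min K1 K2)); first by rewrite !lt_min K0 K10.
move=> f g z fn gn f0 zab m w.
have f0c := horner_ge0_itvcc ab f0.
have m0 : 0 <= m.
  by apply: Rintegral_ge0 => x /=; rewrite in_itv/= => /f0.
have w0 : 0 <= w.
  apply: Rintegral_ge0 => x /=; rewrite in_itv/= => /f0 fx.
  by rewrite -mulrA -expr2 mulr_ge0// sqr_ge0.
have zI : al <= z <= be.
  by move: zab; rewrite !inE => /orP[]/eqP->; rewrite lexx (ltW ab).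
(* The bound [K f(x) g(y)^2 <= w] holds for every [x]; integrating it in [x] produces the mass and
   the factor [be - al]. *)
have Hm y : al <= y <= be -> K1 * m * g.[y] ^+ 2 <= w.
  move=> yab.
  have : integral_oo al be (fun x => (K * g.[y] ^+ 2) * f.[x]) <=
      integral_oo al be (fun=> w).
    apply: le_Rintegral => //.
    - have := horner_integrable al be ((K * g.[y] ^+ 2) *: f).
      by apply: eq_integrable_oo => x _; rewrite hornerZ.
    - exact: integrable_oo_cst.
    move=> x /=; rewrite in_itv/= => /andP[x1 x2].
    rewrite mulrAC; apply: HK => //.
    by rewrite !ltW.
  rewrite integral_oo_cst ?(ltW ab)// integral_ooZl; last exact: horner_integrable.
  rewrite -ler_pdivrMr ?subr_gt0//; apply: le_trans.
  by rewrite le_eqVlt; apply/orP; left; apply/eqP; rewrite /K1 /m; ring.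
split.
- have := HK f 1 z z fn _ f0 zI zI.
  rewrite size_poly1 => /(_ isT); rewrite hornerC expr1n mulr1.
  have -> : integral_oo al be
      (fun x => f.[x] * (1 : {poly R}).[x] * (1 : {poly R}).[x]) = m.
    by apply: eq_Rintegral => x _; rewrite hornerC !mulr1.
  apply: le_trans; rewrite ler_wpM2r ?f0c//.
  by rewrite ge_min lexx.
- apply: (le_trans _ (Hm z zI)).
  apply: ler_wpM2r; [exact: sqr_ge0|apply: ler_wpM2r => //].
  by rewrite !ge_min lexx orbT.
- apply: (@le_trans _ _ (K2 * m * g^`().[z] ^+ 2)).
    apply: ler_wpM2r; [exact: sqr_ge0|apply: ler_wpM2r => //].
    by rewrite !ge_min lexx !orbT.
  (* For positive mass, [Hm] bounds [g] uniformly by [e] on the cell, and the inverse inequality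
     passes to the derivative. *)
  have [m00|mne] := eqVneq m 0; first by rewrite m00 mulr0 mul0r.
  have mpos : 0 < m by rewrite lt_neqAle eq_sym mne.
  pose e := Num.sqrt (w / (K1 * m)).
  have e2 : e ^+ 2 = w / (K1 * m) by rewrite sqr_sqrtr// divr_ge0// ltW// mulr_gt0.
  have ge x : al <= x <= be -> `|g.[x]| <= e.
    move=> /Hm h; rewrite -ler_sqr ?nnegrE ?sqrtr_ge0// real_normK ?num_real//.
    by rewrite e2 ler_pdivlMr; [rewrite [leLHS]mulrC|exact: mulr_gt0].
  have dg : `|g^`().[z]| <= C * e.
    have [] : z = al \/ z = be.
      by move: zab; rewrite !inE => /orP[]/eqP; [left|right].
      move=> ->; rewrite (le_trans (HC1 _ _ gn ge))// ler_wpM2r ?sqrtr_ge0//.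
      by rewrite le_max lexx.
    move=> ->; rewrite (le_trans (HC2 _ _ gn ge))// ler_wpM2r ?sqrtr_ge0//.
    by rewrite le_max lexx orbT.
  have : g^`().[z] ^+ 2 <= (C * e) ^+ 2.
    rewrite -[leLHS]real_normK ?num_real// ler_sqr ?nnegrE//.
    by rewrite mulr_ge0 ?sqrtr_ge0// ltW.
  rewrite exprMn e2 => h.
  have Km0 : 0 <= K2 * m by rewrite mulr_ge0// ltW.
  have := ler_wpM2l Km0 h; move/le_trans; apply.
  rewrite le_eqVlt; apply/orP; left; apply/eqP; rewrite /K2; field.
  by rewrite !gt_eqF.
Qed.

(** * Derivatives of increments *)

Lemma is_derive1P (R : realType) (f : R -> R) (t d : R) :
  is_derive t 1 f d <-> h^-1 * (f (h + t) - f t) @[h --> 0^'] --> d.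
Proof.
have E : (fun h => h^-1 *: ((f \o shift t) (h *: 1) - f t)) =
         (fun h => h^-1 * (f (h + t) - f t)).
  by apply/funext => h /=; rewrite /GRing.scale/= mulr1.
split.
  move=> [df <-]; move: df; rewrite /derivable /derive E.
  exact.
move=> cv; apply: DeriveDef.
  by rewrite /derivable E; apply/cvg_ex; exists d.
by rewrite /derive E; exact: cvg_lim.
Qed.

Lemma cvg_shift0 (R : realType) (w : R -> R) (t : R) : {for t, continuous w} ->
  w (h + t) @[h --> 0^'] --> w t.
Proof.
move=> wt.
have h0 : (h + t) @[h --> (0 : R)] --> t.
  rewrite -[X in _ --> X](add0r t); apply: cvgD; [exact: cvg_id|exact: cvg_cst].
have cv : w (h + t) @[h --> (0 : R)] --> w t.
  exact: (@cvg_comp _ _ _ (fun h => h + t) w _ _ _ h0 wt).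
by apply: (cvg_trans _ cv); apply: cvg_app; exact: cvg_within.
Qed.

(** A product rule in which [w] need only be continuous: the first factor vanishes at [t], so the
    difference quotient is that of [u] times [w (t + h)]. *)
Lemma is_derive_increment_mul (R : realType) (u w : R -> R) (t du : R) :
  is_derive t 1 u du -> {for t, continuous w} ->
  is_derive t 1 (fun s => (u s - u t) * w s) (du * w t).
Proof.
move=> /is_derive1P ut wt; apply/is_derive1P.
have cv := cvgM ut (cvg_shift0 wt); apply: (cvg_trans _ (cv _)); apply: near_eq_cvg.
by near=> h; rewrite subrr mul0r subr0 mulrA.
Unshelve. all: by end_near. Qed.

(** The difference quotients of [l] and [u] enclose that of [f], in reversed order when [h < 0]. *)
Lemma is_derive_squeeze (R : realType) (f l u : R -> R) (t d : R) :
  (\forall s \near t, l s <= f s - f t <= u s) -> l t = 0 -> u t = 0 ->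
  is_derive t 1 l d -> is_derive t 1 u d -> is_derive t 1 f d.
Proof.
move=> lfu l0 u0 /is_derive1P dl /is_derive1P du; apply/is_derive1P.
apply/cvgrPdist_lt => e e0; near=> h.
have hl : `|d - h^-1 * (l (h + t) - l t)| < e.
  by near: h; move/cvgrPdist_lt : dl; exact.
have hu : `|d - h^-1 * (u (h + t) - u t)| < e.
  by near: h; move/cvgrPdist_lt : du; exact.
have h0 : h != 0 by near: h; exact: nbhs_dnbhs_neq.
have /andP[lf fu] : l (h + t) <= f (h + t) - f t <= u (h + t).
  near: h; have : (h + t) @[h --> (0 : R)^'] --> t.
    exact: (@cvg_shift0 R id t (@cvg_id _ _)).
  by move=> /(_ _ lfu).
move: hl hu; rewrite l0 u0 !subr0 !ltr_norml => /andP[l1 l2] /andP[u1 u2].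
move: h0; rewrite neq_lt => /orP[hn|hp].
  have := ler_wnM2l _ lf; have := ler_wnM2l _ fu.
  have hi : h^-1 <= 0 by rewrite invr_le0 ltW.
  by move=> /(_ _ hi) h1 /(_ _ hi) h2; apply/andP; split; lra.
have hi : 0 <= h^-1 by rewrite invr_ge0 ltW.
have h1 := ler_wpM2l hi lf; have h2 := ler_wpM2l hi fu.
by apply/andP; split; lra.
Unshelve. all: by end_near. Qed.

Lemma is_derive_big (R : realType) (I : eqType) (r : seq I) (F : I -> R -> R)
    (D : I -> R) (t : R) :
  (forall i, i \in r -> is_derive t 1 (F i) (D i)) ->
  is_derive t 1 (fun s => \sum_(i <- r) F i s) (\sum_(i <- r) D i).
Proof.
elim: r => [|i r IH] FD.
  rewrite big_nil; have -> : (fun s => \sum_(i <- [::]) F i s) = cst 0 :> (R -> R).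
    by apply/funext => s; rewrite big_nil.
  exact: is_derive_cst.
rewrite big_cons.
have -> : (fun s => \sum_(j <- i :: r) F j s) =
    F i + (fun s => \sum_(j <- r) F j s).
  by apply/funext => s; rewrite big_cons fctE.
apply: is_deriveD; first by apply: FD; rewrite mem_head.
by apply: IH => j jr; apply: FD; rewrite in_cons jr orbT.
Qed.

(** * Summation of the numerical fluxes *)

Lemma sum_on_bdry (R : realType) (N : nat) (G : nat -> nat -> R) : (0 < N)%N ->
  \sum_(0 <= j < N) on_bdry j (G j) =
  G N.-1 N - G 0%N 0%N - \sum_(1 <= e < N) (G e e - G e.-1 e).
Proof.
case: N => // n _; rewrite /on_bdry !sumrB.
rewrite big_nat_recr//= [X in _ - X = _]big_nat_recl//= big_add1/=.
by rewrite [\sum_(1 <= e < n.+1) G e.-1 e]big_add1/=; ring.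
Qed.

Section FluxAlgebra.
Context (R : realType) (a b : R) (N : nat) (K : mesh a b N).
Implicit Types (u v M : pwpoly R) (B : fluxpar R).

(** At the endpoints [u - {u}] vanishes by the convention on averages. At an interior interface
    [u - {u}] is plus or minus half the jump of [u], so the two cells together contribute [[u]
    {v'}]. *)
Lemma sum_flux B (ga gb : R) M u v : (0 < N)%N ->
  \sum_(0 <= j < N) on_bdry j (fun e =>
     avg K M e * (flux K B ga gb u e * (v j).[node K e]
       + ((u j).[node K e] - avg K u e) * (pwderiv v j).[node K e])) =
  avg K M N * gb * left_lim K v N - avg K M 0 * ga * right_lim K v 0
  - \sum_(1 <= e < N)
      avg K M e * (Fl K B u e * jump K v e + avg K (pwderiv v) e * jump K u e).
Proof.
move=> N0; have Nn0 : (N == 0%N) = false by rewrite gtn_eqF.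
rewrite sum_on_bdry//; congr (_ - _ - _).
- by rewrite /flux /avg Nn0 eqxx /left_lim subrr mul0r addr0 mulrA.
- by rewrite /flux /avg eqxx /right_lim subrr mul0r addr0 mulrA.
- apply: eq_big_nat => e /andP[e0 eN].
  have eN0 : (e == 0%N) = false by rewrite gtn_eqF.
  have eNN : (e == N) = false by rewrite ltn_eqF.
  rewrite -mulrBr; congr (_ * _).
  rewrite /flux eN0 eNN {2 3}/avg eN0 eNN /jump -/(right_lim K v e).
  rewrite -/(left_lim K v e) -/(right_lim K u e) -/(left_lim K u e).
  rewrite -/(right_lim K (pwderiv v) e) -/(left_lim K (pwderiv v) e).
  rewrite /avg eN0 eNN.
  by field.
Qed.

(** Without the second-derivative term the interface bracket is [beta0 [u][v] / h + {u'}[v] +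
    {v'}[u]]. *)
Lemma A_form_sym B M u v : beta1 B = 0 -> A_form K B M u v = A_form K B M v u.
Proof.
move=> b0; rewrite /A_form; congr (_ + _).
  apply: eq_bigr => j _; apply: eq_Rintegral => x _; exact: mulrAC.
by apply: eq_bigr => e _; rewrite /Fl b0; congr (_ * _); ring.
Qed.

Lemma A_form_const B M u (r : R) : A_form K B M u (fun=> r%:P) = 0.
Proof.
rewrite /A_form !big1 ?addr0// => [e _|j _].
  have -> : avg K (pwderiv (fun=> r%:P)) e = 0.
    rewrite /avg /right_lim /left_lim /pwderiv /= derivC horner0.
    by do 2 case: ifP => //; rewrite addr0 mul0r.
  by rewrite /jump /right_lim /left_lim !hornerC subrr mulr0 mul0r addr0 mulr0.
transitivity (Rintegral (@lebesgue_measure R) (cell K j) (cst 0)).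
  by apply: eq_Rintegral => x _; rewrite /pwderiv /= derivC horner0 mulr0.
by rewrite /cell Rintegral_cst ?mul0r.
Qed.

Lemma avg_const (r : R) e : avg K (fun=> r%:P) e = r.
Proof.
rewrite /avg /right_lim /left_lim !hornerC.
by do 2 (case: ifP => _ //); field.
Qed.

End FluxAlgebra.

Lemma mesh_gt0 (R : realType) (a b : R) (N : nat) (K : mesh a b N) : a < b ->
  (0 < N)%N.
Proof.
case: N K => // K; have := node_first K; have := node_last K => /= -> ->.
by rewrite ltxx.
Qed.

Lemma scheme_c_sum (R : realType) (a b : R) N (K : mesh a b N) k m
    (Bp : fluxpar R) (c p : 'I_m -> R -> pwpoly R) (t : R) (i : 'I_m)
    (v : pwpoly R) : (0 < N)%N -> v \in Vh N k -> scheme_c K k Bp c p t ->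
  \sum_(0 <= j < N) cellint K j (fun x => dt (c i) t j x * (v j).[x]) =
  - A_form K Bp (c i t) (p i t) v.
Proof.
move=> N0 vV sc; rewrite (eq_big_nat _ _ (fun j (jN : (0 <= j < N)%N) =>
  sc i v vV j (proj2 (andP jN)))).
by rewrite big_split/= sumrN sum_flux// !mulr0 !mul0r subrr sub0r /A_form opprD.
Qed.

Lemma scheme_psi_sum (R : realType) (a b : R) N (K : mesh a b N) k m
    (P : pnp_data R m) (B : fluxpar R) (c : 'I_m -> R -> pwpoly R)
    (psi : R -> pwpoly R) (t : R) (eta : pwpoly R) :
  (0 < N)%N -> eta \in Vh N k -> scheme_psi K k P B c psi t ->
  A_form K B (fun=> 1%:P) (psi t) eta =
  \sum_(0 <= j < N) cellint K j (fun x => chargedens P c t j x * (eta j).[x])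
  + (sigma_b P t * left_lim K eta N - sigma_a P t * right_lim K eta 0).
Proof.
move=> N0 eV sc.
rewrite -(eq_big_nat _ _ (fun j (jN : (0 <= j < N)%N) =>
  sc eta eV j (proj2 (andP jN)))).
rewrite sumrB.
(* The average of the constant weight [1] is inserted to match the shape of [sum_flux]. *)
have -> : \sum_(0 <= j < N) on_bdry j (fun e =>
      flux K B (sigma_a P t) (sigma_b P t) (psi t) e * (eta j).[node K e] +
      ((psi t j).[node K e] - avg K (psi t) e) * (pwderiv eta j).[node K e]) =
    \sum_(0 <= j < N) on_bdry j (fun e => avg K (fun=> 1%:P) e *
      (flux K B (sigma_a P t) (sigma_b P t) (psi t) e * (eta j).[node K e] +
      ((psi t j).[node K e] - avg K (psi t) e) * (pwderiv eta j).[node K e])).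
  by apply: eq_bigr => j _; rewrite /on_bdry !avg_const !mul1r.
rewrite sum_flux// !avg_const !mul1r /A_form.
have -> : \sum_(0 <= j < N) cellint K j (fun x =>
      (1%:P : {poly R}).[x] * (pwderiv (psi t) j).[x] * (pwderiv eta j).[x]) =
    \sum_(0 <= j < N) cellint K j (fun x =>
      (pwderiv (psi t) j).[x] * (pwderiv eta j).[x]).
  apply: eq_bigr => j _; apply: eq_Rintegral => x _.
  by rewrite hornerC mul1r.
ring.
Qed.

(** * Linearity of the integral, and time derivatives of integrals of polynomials *)

Lemma integral_ooD (R : realType) (al be : R) (f g : R -> R) :
  integrable_oo al be f -> integrable_oo al be g ->
  integral_oo al be (fun x => f x + g x) = integral_oo al be f + integral_oo al be g.
Proof. by move=> fi gi; exact: RintegralD. Qed.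

Lemma integral_ooB (R : realType) (al be : R) (f g : R -> R) :
  integrable_oo al be f -> integrable_oo al be g ->
  integral_oo al be (fun x => f x - g x) = integral_oo al be f - integral_oo al be g.
Proof. by move=> fi gi; exact: RintegralB. Qed.

Lemma integrable_ooZl (R : realType) (al be r : R) (f : R -> R) :
  integrable_oo al be f -> integrable_oo al be (fun x => r * f x).
Proof. by move=> fi; exact: (integrableZl _ _ fi). Qed.

Lemma eq_integral_oo (R : realType) (al be : R) (f g : R -> R) :
  (forall x, al < x < be -> f x = g x) -> integral_oo al be f = integral_oo al be g.
Proof.
by move=> fg; apply: eq_Rintegral => x; rewrite inE/= in_itv/= => /fg.
Qed.

Lemma integrable_oo_big (R : realType) (al be : R) (I : Type) (r : seq I)
    (f : I -> R -> R) : (forall i, integrable_oo al be (f i)) ->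
  integrable_oo al be (fun x => \sum_(i <- r) f i x).
Proof.
move=> fi; elim: r => [|i r IH].
  apply: eq_integrable_oo (integrable_oo_cst al be 0) => x _.
  by rewrite big_nil.
apply: eq_integrable_oo (integrable_ooD (fi i) IH) => x _.
by rewrite big_cons.
Qed.

Lemma integral_oo_big (R : realType) (al be : R) (I : Type) (r : seq I)
    (f : I -> R -> R) : (forall i, integrable_oo al be (f i)) ->
  integral_oo al be (fun x => \sum_(i <- r) f i x) =
  \sum_(i <- r) integral_oo al be (f i).
Proof.
move=> fi; elim: r => [|i r IH].
  rewrite big_nil (@eq_integral_oo _ _ _ _ (cst 0)).
    by rewrite Rintegral_cst ?mul0r.
  by move=> x _; rewrite big_nil.
rewrite big_cons -IH -integral_ooD//; last exact: integrable_oo_big.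
by apply: eq_integral_oo => x _; rewrite big_cons.
Qed.

Lemma horner_expansion (R : realType) n (L : 'I_n.+1 -> {poly R})
    (X : nat -> R) (p : {poly R}) (x : R) :
  p = \sum_(i < n.+1) p.[X i] *: L i -> 
  p.[x] = \sum_(i < n.+1) p.[X i] * (L i).[x].
Proof.
move=> {1}->; rewrite horner_sum; apply: eq_bigr => i _; exact: hornerZ.
Qed.

(** The values at [n.+1] fixed nodes are coordinates, and they are differentiable in time; the limit
    stays in the same finite-dimensional space. *)
Lemma derive_horner_curve (R : realType) (n : nat) (q : R -> {poly R}) (t : R) :
  (\forall s \near t, (size (q s) <= n.+1)%N) ->
  (forall x, derivable (fun s => (q s).[x]) t 1) ->
  exists2 Q : {poly R}, (size Q <= n.+1)%N &
    forall x, 'D_1 (fun s => (q s).[x]) t = Q.[x].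
Proof.
move=> qn qd.
have Xinj : injective (fun l : nat => l%:R : R).
  by move=> i j /eqP; rewrite eqr_nat => /eqP.
have [L [Ln LE]] := lagrange_expansion n Xinj.
pose d (x : R) := 'D_1 (fun s => (q s).[x]) t.
exists (\sum_(i < n.+1) d i%:R *: L i).
  rewrite (leq_trans (size_sum _ _ _))//; apply/bigmax_leqP => i _.
  by rewrite (leq_trans (size_scale_leq _ _)).
move=> x.
have h : is_derive t 1 (fun s => \sum_(i < n.+1) ((q s).[i%:R] * (L i).[x]))
    (\sum_(i < n.+1) d i%:R * (L i).[x]).
  apply: is_derive_big => i _.
  have qi : is_derive t 1 (fun s => (q s).[i%:R]) (d i%:R) by exact: derivableP.
  have := @is_deriveM R R (fun s => (q s).[i%:R]) (cst (L i).[x]) t 1 _ _ qi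
    (is_derive_cst _ _ _).
  rewrite scaler0 add0r /GRing.scale/= [(L i).[x] * _]mulrC => H; exact: H.
have h1 : is_derive t 1 (fun s => (q s).[x]) (\sum_(i < n.+1) d i%:R * (L i).[x]).
  apply: near_eq_is_derive h; near=> s.
  apply/esym; apply: horner_expansion; apply: LE.
  by near: s.
rewrite (@derive_val _ _ _ _ _ _ _ h1) horner_sum.
by apply: eq_bigr => i _; rewrite hornerZ.
Unshelve. all: by end_near. Qed.

(** In the Lagrange basis the integral is a finite bilinear form in point values, with the constant
    Gram matrix [J]; the product rule for increments then applies to each entry, with no limit under
    the integral. *)
Lemma is_derive_integral_increment (R : realType) (al be : R) (n : nat)
    (q r : R -> {poly R}) (t : R) :
  (\forall s \near t, (size (q s) <= n.+1)%N) ->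
  (\forall s \near t, (size (r s) <= n.+1)%N) ->
  (forall x, derivable (fun s => (q s).[x]) t 1) ->
  (forall x, {for t, continuous (fun s => (r s).[x])}) ->
  is_derive t 1
    (fun s => integral_oo al be (fun x => ((q s).[x] - (q t).[x]) * (r s).[x]))
    (integral_oo al be (fun x => 'D_1 (fun s => (q s).[x]) t * (r t).[x])).
Proof.
move=> qn rn qd rc.
have Xinj : injective (fun l : nat => l%:R : R).
  by move=> i j /eqP; rewrite eqr_nat => /eqP.
have [L [Ln LE]] := lagrange_expansion n Xinj.
have [Q Qn QE] := derive_horner_curve qn qd.
pose J i j := integral_oo al be (fun x => (L i * L j).[x]).
have expand (f g : {poly R}) : (size f <= n.+1)%N -> (size g <= n.+1)%N ->
    integral_oo al be (fun x => f.[x] * g.[x]) =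
    \sum_(i < n.+1) \sum_(j < n.+1) f.[i%:R] * (g.[j%:R] * J i j).
  move=> /LE fE /LE gE.
  transitivity (integral_oo al be (fun x => \sum_(i < n.+1) \sum_(j < n.+1)
      f.[i%:R] * (g.[j%:R] * (L i * L j).[x]))).
    apply: eq_integral_oo => x _.
    rewrite (horner_expansion x fE) (horner_expansion x gE) mulr_suml.
    apply: eq_bigr => i _; rewrite mulr_sumr; apply: eq_bigr => j _.
    by rewrite hornerM mulrACA -!mulrA.
  have ii (i j : 'I_n.+1) : integrable_oo al be
      (fun x => f.[i%:R] * (g.[j%:R] * (L i * L j).[x])).
    by do 2 apply: integrable_ooZl; exact: horner_integrable.
  rewrite integral_oo_big; last first.
    by move=> i; apply: integrable_oo_big => j; exact: ii.
  apply: eq_bigr => i _; rewrite integral_oo_big; last by move=> j; exact: ii.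
  apply: eq_bigr => j _; rewrite integral_ooZl; last first.
    by apply: integrable_ooZl; exact: horner_integrable.
  by rewrite integral_ooZl//; exact: horner_integrable.
have qt : (size (q t) <= n.+1)%N by exact: nbhs_singleton qn.
have rt : (size (r t) <= n.+1)%N by exact: nbhs_singleton rn.
have h : is_derive t 1 (fun s => \sum_(i < n.+1) \sum_(j < n.+1)
      ((q s).[i%:R] - (q t).[i%:R]) * ((r s).[j%:R] * J i j))
    (\sum_(i < n.+1) \sum_(j < n.+1) Q.[i%:R] * ((r t).[j%:R] * J i j)).
  apply: is_derive_big => i _; apply: is_derive_big => j _.
  apply: (@is_derive_increment_mul _ (fun s => (q s).[i%:R])
    (fun s => (r s).[j%:R] * J i j)).
    by rewrite -QE; exact: derivableP.
  by apply: cvgM; [exact: rc|exact: cvg_cst].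
have -> : integral_oo al be (fun x => 'D_1 (fun s => (q s).[x]) t * (r t).[x]) =
    \sum_(i < n.+1) \sum_(j < n.+1) Q.[i%:R] * ((r t).[j%:R] * J i j).
  by rewrite -expand//; apply: eq_integral_oo => x _; rewrite QE.
apply: near_eq_is_derive h; near=> s.
have qs : (size (q s) <= n.+1)%N by near: s.
have rs : (size (r s) <= n.+1)%N by near: s.
have dn : (size (q s - q t)%R <= n.+1)%N.
  by rewrite (leq_trans (size_polyD _ _))// size_polyN geq_max qs.
transitivity (\sum_(i < n.+1) \sum_(j < n.+1)
    (q s - q t).[i%:R] * ((r s).[j%:R] * J i j)).
  by apply: eq_bigr => i _; apply: eq_bigr => j _; rewrite !hornerE.
rewrite -expand//; apply: eq_integral_oo => x _.
by rewrite !hornerE.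
Unshelve. all: by end_near. Qed.

(** * Convexity and the time derivative of the entropy *)

Lemma is_derive_cstMl (R : realType) (f : R -> R) (t d r : R) :
  is_derive t 1 f d -> is_derive t 1 (fun s => r * f s) (r * d).
Proof. by move=> fd; exact: (is_deriveZ r fd). Qed.

(** The graph of [x ln x] lies above its tangent at [y]; this amounts to
    [ln (y / x) <= y / x - 1]. *)
Lemma mul_ln_convex (R : realType) (x y : R) : 0 < x -> 0 < y ->
  (x - y) * (ln y + 1) <= x * ln x - y * ln y.
Proof.
move=> x0 y0; have := @le_ln1Dx R (y / x - 1).
rewrite ltrBrDl addrN divr_gt0// => /(_ isT).
rewrite addrC subrK ln_div ?posrE// => h.
have := ler_wpM2l (ltW x0) h.
have -> : x * (y / x - 1) = y - x by field; rewrite gt_eqF.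
by move=> ?; lra.
Qed.

(* No domination is needed: [ln (q s)] only enters through its projection [r],
   as the convexity of [x ln x] squeezes the increments of the entropy between
   two integrals against polynomials. *)
Lemma is_derive_entropy (R : realType) (al be : R) (n : nat)
    (q r : R -> {poly R}) (t : R) :
  (\forall s \near t, (size (q s) <= n.+1)%N) ->
  (\forall s \near t, (size (r s) <= n.+1)%N) ->
  (forall x, derivable (fun s => (q s).[x]) t 1) ->
  (forall x, {for t, continuous (fun s => (r s).[x])}) ->
  (\forall s \near t, forall x, al < x < be -> 0 < (q s).[x]) ->
  (\forall s \near t, forall p : {poly R}, (size p <= n.+1)%N ->
     integral_oo al be (fun x => (r s).[x] * p.[x]) =
     integral_oo al be (fun x => ln (q s).[x] * p.[x])) ->
  is_derive t 1 (fun s => integral_oo al be (fun x => (q s).[x] * ln (q s).[x]))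
    (integral_oo al be (fun x => 'D_1 (fun s => (q s).[x]) t * ((r t).[x] + 1))).
Proof.
move=> qn rn qd rc q0 rE.
have qt0 := nbhs_singleton q0; have rEt := nbhs_singleton rE.
have qnt : (size (q t) <= n.+1)%N by exact: nbhs_singleton qn.
have r1n s : (size (r s) <= n.+1)%N -> (size (r s + 1)%R <= n.+1)%N.
  by move=> rs; rewrite (leq_trans (size_polyD _ _))// size_poly1 geq_max rs.
have -> : integral_oo al be
      (fun x => 'D_1 (fun s => (q s).[x]) t * ((r t).[x] + 1)) =
    integral_oo al be (fun x => 'D_1 (fun s => (q s).[x]) t * (r t + 1).[x]).
  by apply: eq_integral_oo => x _; rewrite !hornerE.
have ln_int s (p : {poly R}) : (forall x, al < x < be -> 0 < (q s).[x]) ->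
    integrable_oo al be (fun x => ln (q s).[x] * p.[x]).
  by move=> /integrable_ln_horner; exact: integrable_mul_horner.
have ent_int s : (forall x, al < x < be -> 0 < (q s).[x]) ->
    integrable_oo al be (fun x => (q s).[x] * ln (q s).[x]).
  move=> /(@ln_int s (q s)); apply: eq_integrable_oo => x _; exact: mulrC.
(* Against polynomials of degree at most [n], the projection [r s] may be exchanged for
   [ln (q s)]. *)
have key s (p : {poly R}) : (size p <= n.+1)%N ->
    (forall x, al < x < be -> 0 < (q s).[x]) ->
    (forall p : {poly R}, (size p <= n.+1)%N ->
     integral_oo al be (fun x => (r s).[x] * p.[x]) =
     integral_oo al be (fun x => ln (q s).[x] * p.[x])) ->
    integral_oo al be (fun x => p.[x] * (r s + 1).[x]) =
    integral_oo al be (fun x => ln (q s).[x] * p.[x] + p.[x]).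
  move=> pn qs0 rEs; rewrite integral_ooD; last first.
  - exact: horner_integrable.
  - exact: ln_int.
  rewrite -rEs// -integral_ooD; last first.
  - exact: horner_integrable.
  - have := horner_integrable al be (r s * p).
    by apply: eq_integrable_oo => x _; rewrite hornerM.
  by apply: eq_integral_oo => x _; rewrite !hornerE; ring.
(* The tangent at [q t] gives the lower bound, the tangent at [q s] the upper one. Both have the
   same derivative at [t], since [r] is continuous there. *)
apply: (@is_derive_squeeze _ _
  (fun s => integral_oo al be (fun x => ((q s).[x] - (q t).[x]) * (r t + 1).[x]))
  (fun s => integral_oo al be (fun x => ((q s).[x] - (q t).[x]) * (r s + 1).[x]))).
- near=> s.
  have qs : (size (q s) <= n.+1)%N by near: s.
  have qs0 : forall x, al < x < be -> 0 < (q s).[x] by near: s.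
  have rEs : forall p : {poly R}, (size p <= n.+1)%N ->
     integral_oo al be (fun x => (r s).[x] * p.[x]) =
     integral_oo al be (fun x => ln (q s).[x] * p.[x]) by near: s.
  have dn : (size (q s - q t)%R <= n.+1)%N.
    by rewrite (leq_trans (size_polyD _ _))// size_polyN geq_max qs.
  have E u : integral_oo al be
        (fun x => ((q s).[x] - (q t).[x]) * (r u + 1).[x]) =
      integral_oo al be (fun x => (q s - q t).[x] * (r u + 1).[x]).
    by apply: eq_integral_oo => x _; rewrite !hornerE.
  rewrite !E key// key// -integral_ooB; try exact: ent_int.
  have di : integrable_oo al be
      (fun x => (q s).[x] * ln (q s).[x] - (q t).[x] * ln (q t).[x]).
    by apply: integrable_ooB; exact: ent_int.
  have bi u : (forall x, al < x < be -> 0 < (q u).[x]) -> integrable_oo al be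
      (fun x => ln (q u).[x] * (q s - q t).[x] + (q s - q t).[x]).
    by move=> /ln_int qu; apply: integrable_ooD => //; exact: horner_integrable.
  apply/andP; split; apply: le_Rintegral => //; try exact: bi.
    move=> x /=; rewrite in_itv/= => abx.
    by have := mul_ln_convex (qs0 _ abx) (qt0 _ abx); rewrite hornerD hornerN; lra.
  move=> x /=; rewrite in_itv/= => abx.
  by have := mul_ln_convex (qt0 _ abx) (qs0 _ abx); rewrite hornerD hornerN; lra.
- rewrite (@eq_integral_oo _ _ _ _ (cst 0)) ?Rintegral_cst ?mul0r// => x _.
  by rewrite subrr mul0r.
- rewrite (@eq_integral_oo _ _ _ _ (cst 0)) ?Rintegral_cst ?mul0r// => x _.
  by rewrite subrr mul0r.
- apply: (@is_derive_integral_increment _ _ _ n q (fun=> r t + 1)) => //.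
    by near=> s; apply: r1n; exact: nbhs_singleton rn.
  by move=> x; exact: cst_continuous.
- apply: (@is_derive_integral_increment _ _ _ n q (fun s => r s + 1)) => //.
    by near=> s; apply: r1n; near: s.
  move=> x; have -> : (fun s => (r s + 1).[x]) = (fun s => (r s).[x] + 1).
    by apply/funext => s; rewrite !hornerE.
  by apply: cvgD; [exact: rc|exact: cvg_cst].
Unshelve. all: by end_near. Qed.

(** * Neighbourhoods in the time interval, nodes of the mesh, and the space [Vh] *)

Lemma near_lt_ereal (R : realType) (t : R) (T : \bar R) : 0 < t -> (t%:E < T)%E ->
  \forall s \near t, 0 < s /\ (s%:E < T)%E.
Proof.
move=> t0 tT; apply: filterI; first exact: lt_nbhsr.
case: T tT => [T|_|//].
  rewrite lte_fin => tT; near=> s; rewrite lte_fin; near: s; exact: lt_nbhsl.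
by near=> s; exact: ltry.
Unshelve. all: by end_near. Qed.

Lemma node_bounds (R : realType) (a b : R) (N : nat) (K : mesh a b N) (j : nat) :
  (j <= N)%N -> a <= node K j <= b.
Proof.
move=> jN; apply/andP; split.
  elim: j jN => [|j IH] jN; first by rewrite node_first.
  by rewrite (le_trans (IH (ltnW jN)))// ltW// node_incr.
suff h d i : (i + d = N)%N -> node K i <= node K N.
  by have := h _ _ (subnKC jN); rewrite node_last.
elim: d i => [|d IH] i iN; first by move: iN; rewrite addn0 => ->.
have : (i < N)%N by rewrite -iN addnS ltnS leq_addr.
move=> /(node_incr K)/ltW/le_trans; apply.
by apply: IH; rewrite addSnnS.
Qed.

Lemma VhP (R : realType) (N k j : nat) (v : pwpoly R) :
  v \in Vh N k -> (j < N)%N -> (size (v j) <= k.+1)%N.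
Proof. by move=> /set_mem; exact. Qed.

Lemma Vh_const (R : realType) (N k : nat) (p : {poly R}) :
  (size p <= k.+1)%N -> (fun=> p) \in Vh N k.
Proof. by move=> pk; apply/mem_set. Qed.

(** * The energy identity *)

Section Solution.
Context (R : realType) (a b : R) (hab : a < b) (N : nat) (K : mesh a b N)
  (k m : nat) (P : pnp_data R m) (Bp Bpsi : fluxpar R) (T : \bar R)
  (c p : 'I_m -> R -> pwpoly R) (psi : R -> pwpoly R).
Context (adm : admissible_data a b P) (sol : dg_solution K k P Bp Bpsi c p psi T).
Context (t : R) (t0 : 0 < t) (tT : (t%:E < T)%E).

Let N0 : (0 < N)%N := mesh_gt0 K hab.

Lemma size_c_near i j : (j < N)%N -> \forall s \near t, (size (c i s j) <= k.+1)%N.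
Proof.
move=> jN; near=> s; have [s0 sT] : 0 < s /\ (s%:E < T)%E.
  by near: s; exact: near_lt_ereal.
by have [cV _ _] := sol_Vh sol s0 sT; exact: VhP jN.
Unshelve. all: by end_near. Qed.

Lemma size_p_near i j : (j < N)%N -> \forall s \near t, (size (p i s j) <= k.+1)%N.
Proof.
move=> jN; near=> s; have [s0 sT] : 0 < s /\ (s%:E < T)%E.
  by near: s; exact: near_lt_ereal.
by have [_ pV _] := sol_Vh sol s0 sT; exact: VhP jN.
Unshelve. all: by end_near. Qed.

Lemma size_psi_near j : (j < N)%N -> \forall s \near t, (size (psi s j) <= k.+1)%N.
Proof.
move=> jN; near=> s; have [s0 sT] : 0 < s /\ (s%:E < T)%E.
  by near: s; exact: near_lt_ereal.
by have [_ _ psiV] := sol_Vh sol s0 sT; exact: VhP jN.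
Unshelve. all: by end_near. Qed.

Lemma dt_c_poly i j : (j < N)%N -> exists2 Q : {poly R}, (size Q <= k.+1)%N &
  forall x, dt (c i) t j x = Q.[x].
Proof.
move=> jN; apply: derive_horner_curve; first exact: size_c_near.
by move=> x; exact: (sol_c_derivable sol).
Qed.

Lemma is_derive_total_conc i : is_derive t 1 (total_conc K c i) 0.
Proof.
have d j : j \in index_iota 0 N -> is_derive t 1 (fun s => cellint K j
      (fun x => ((c i s j).[x] - (c i t j).[x]) * (1%:P : {poly R}).[x]))
    (cellint K j (fun x => dt (c i) t j x * (1%:P : {poly R}).[x])).
  rewrite mem_index_iota => /andP[_ jN].
  apply: (@is_derive_integral_increment _ _ _ k (fun s => c i s j) (fun=> 1%:P)).
  - exact: size_c_near.
  - by near=> s; rewrite (leq_trans (size_polyC_leq1 _)).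
  - by move=> x; exact: (sol_c_derivable sol).
  - by move=> x; exact: cst_continuous.
have [scc _ _] := sol_scheme sol t0 tT.
have one : (fun=> 1%:P) \in @Vh R N k.
  by apply: Vh_const; rewrite (leq_trans (size_polyC_leq1 _)).
have := is_derive_big d.
rewrite (scheme_c_sum i N0 one scc) A_form_const oppr0 => D.
(* Only increments paired with the test function [1] are differentiated; the value at [t] is a
   constant. *)
have -> : total_conc K c i = cst (total_conc K c i t) +
    (fun s => \sum_(j <- index_iota 0 N) cellint K j
      (fun x => ((c i s j).[x] - (c i t j).[x]) * (1%:P : {poly R}).[x])).
  apply/funext => s; rewrite fctE /= /total_conc -big_split/=.
  apply: eq_bigr => j _; rewrite /cellint /cell.
  rewrite -integral_ooD; first last.
  - have := horner_integrable (node K j) (node K j.+1) (c i s j - c i t j).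
    by apply: eq_integrable_oo => x _; rewrite !hornerE.
  - exact: horner_integrable.
  by apply: eq_integral_oo => x _; rewrite hornerC mulr1 addrC subrK.
rewrite -[X in is_derive _ _ _ X]addr0.
exact: is_deriveD (is_derive_cst _ _ _) D.
Unshelve. all: by end_near. Qed.

Lemma integrable_chargedens_mul s j (f : {poly R}) : (j < N)%N ->
  integrable_oo (node K j) (node K j.+1) (fun x => chargedens P c s j x * f.[x]).
Proof.
move=> jN; apply: integrable_mul_horner; apply: integrable_ooD.
  apply: integrable_oo_big => i; apply: integrable_ooZl.
  exact: horner_integrable.
have [rho _ _] := adm.
apply: (integrableS _ _ _ rho) => //; apply: subset_itv; rewrite bnd_simp.
  by have /andP[] := node_bounds K (ltnW jN).
by have /andP[] := node_bounds K jN.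
Qed.

(** The fixed charge [rho0] cancels in the increment, which leaves integrals of polynomials. *)
Lemma integral_chargedens_sub s j (f : {poly R}) : (j < N)%N ->
  cellint K j (fun x => chargedens P c s j x * f.[x]) -
  cellint K j (fun x => chargedens P c t j x * f.[x]) =
  \sum_(i < m) Defs.charge P i *
    cellint K j (fun x => ((c i s j).[x] - (c i t j).[x]) * f.[x]).
Proof.
move=> jN.
rewrite /cellint /cell -integral_ooB; try exact: integrable_chargedens_mul.
have ii i : integrable_oo (node K j) (node K j.+1)
    (fun x => ((c i s j).[x] - (c i t j).[x]) * f.[x]).
  have := horner_integrable (node K j) (node K j.+1) ((c i s j - c i t j) * f).
  by apply: eq_integrable_oo => x _; rewrite !hornerE.
transitivity (integral_oo (node K j) (node K j.+1) (fun x => \sum_(i < m)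
    Defs.charge P i * (((c i s j).[x] - (c i t j).[x]) * f.[x]))).
  apply: eq_integral_oo => x _.
  rewrite -mulrBl /chargedens opprD addrACA subrr addr0.
  rewrite -sumrB mulr_suml; apply: eq_bigr => i _.
  by rewrite -mulrBr mulrA.
rewrite integral_oo_big; last by move=> i; exact: integrable_ooZl.
by apply: eq_bigr => i _; rewrite integral_ooZl.
Qed.

(** Twice the electrostatic part of the free energy. When the Poisson equation holds at [s], it
    equals [A_form] with weight [1] at the pair [(psi s, psi s)]. *)
Definition electrostatic s : R :=
  \sum_(0 <= j < N) cellint K j (fun x => chargedens P c s j x * (psi s j).[x])
  + (sigma_b P s * left_lim K (psi s) N - sigma_a P s * right_lim K (psi s) 0).

(* The symmetry of the form lets the increment of the energy be written with
   increments of the data only, so [psi] need not be differentiable in time. *)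
Lemma electrostatic_sub s : beta1 Bpsi = 0 -> 0 < s -> (s%:E < T)%E ->
  electrostatic s - electrostatic t =
  \sum_(0 <= j < N) \sum_(i < m) Defs.charge P i *
     cellint K j (fun x => ((c i s j).[x] - (c i t j).[x]) *
       (psi s j + psi t j).[x])
  + ((sigma_b P s - sigma_b P t) * (left_lim K (psi s) N + left_lim K (psi t) N)
  - (sigma_a P s - sigma_a P t) * (right_lim K (psi s) 0 + right_lim K (psi t) 0)).
Proof.
move=> b1 s0 sT.
have [_ _ sc_t] := sol_scheme sol t0 tT; have [_ _ sc_s] := sol_scheme sol s0 sT.
have [_ _ Vt] := sol_Vh sol t0 tT; have [_ _ Vs] := sol_Vh sol s0 sT.
(* Reciprocity: the data at time [s] tested with [psi t] equal the data at time [t] tested with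
   [psi s], so the cross terms can be added and subtracted. *)
have := scheme_psi_sum N0 Vt sc_s; rewrite A_form_sym// (scheme_psi_sum N0 Vs sc_t).
have -> : \sum_(0 <= j < N) \sum_(i < m) Defs.charge P i *
     cellint K j (fun x => ((c i s j).[x] - (c i t j).[x]) *
       (psi s j + psi t j).[x]) =
   \sum_(0 <= j < N) cellint K j (fun x => chargedens P c s j x * (psi s j).[x]) +
   \sum_(0 <= j < N) cellint K j (fun x => chargedens P c s j x * (psi t j).[x]) -
   (\sum_(0 <= j < N) cellint K j (fun x => chargedens P c t j x * (psi s j).[x]) +
   \sum_(0 <= j < N) cellint K j (fun x => chargedens P c t j x * (psi t j).[x])).
  rewrite -!big_split -sumrB; apply: eq_big_nat => j /andP[_ jN] /=.
  rewrite -integral_chargedens_sub// /cellint /cell.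
  congr (_ - _); rewrite -integral_ooD; try exact: integrable_chargedens_mul;
    by apply: eq_integral_oo => x _; rewrite hornerD mulrDr.
rewrite /electrostatic => h.
set A := \sum_(0 <= j < N) cellint K j
  (fun x => chargedens P c s j x * (psi s j).[x]).
set B := \sum_(0 <= j < N) cellint K j
  (fun x => chargedens P c t j x * (psi t j).[x]).
move: h; set C := \sum_(0 <= j < N) _; set D := \sum_(0 <= j < N) _.
by move=> h; lra.
Qed.

(** The boundary increments have derivative zero because [sigma] is stationary. The sum
    [psi t + psi t] is the factor [2] that the [1/2] in the energy compensates. *)
Lemma is_derive_electrostatic : stationary_sigma P T -> beta1 Bpsi = 0 ->
  is_derive t 1 electrostatic
    (\sum_(0 <= j < N) \sum_(i < m) Defs.charge P i *
      cellint K j (fun x => dt (c i) t j x * (psi t j + psi t j).[x])).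
Proof.
move=> st b1; have [dsa dsb] := st t t0 tT.
pose G s := \sum_(0 <= j < N) \sum_(i < m) Defs.charge P i *
     cellint K j (fun x => ((c i s j).[x] - (c i t j).[x]) *
       (psi s j + psi t j).[x]).
have psic j x : (j < N)%N -> {for t, continuous (fun s => (psi s j + psi t j).[x])}.
  move=> jN; have -> : (fun s => (psi s j + psi t j).[x]) =
      (fun s => (psi s j).[x] + (psi t j).[x]).
    by apply/funext => s; rewrite hornerD.
  by apply: cvgD; [exact: (sol_psi_continuous sol)|exact: cvg_cst].
have dG : is_derive t 1 G (\sum_(0 <= j < N) \sum_(i < m) Defs.charge P i *
      cellint K j (fun x => dt (c i) t j x * (psi t j + psi t j).[x])).
  apply: is_derive_big => j; rewrite mem_index_iota => /andP[_ jN].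
  apply: is_derive_big => i _; apply: is_derive_cstMl.
  apply: (@is_derive_integral_increment _ _ _ k (fun s => c i s j)
    (fun s => psi s j + psi t j)).
  - exact: size_c_near.
  - near=> s; rewrite (leq_trans (size_polyD _ _))// geq_max; apply/andP; split.
      by near: s; exact: size_psi_near.
    exact: nbhs_singleton (size_psi_near jN).
  - by move=> x; exact: (sol_c_derivable sol).
  - by move=> x; exact: psic.
(* The left limit at [b] is read from the polynomial of the last cell, [N.-1]. *)
have N1N : (N.-1 < N)%N by rewrite prednK.
have db : is_derive t 1 (fun s => (sigma_b P s - sigma_b P t) *
    (left_lim K (psi s) N + left_lim K (psi t) N)) 0.
  have := @is_derive_increment_mul R (sigma_b P)
    (fun s => (psi s N.-1 + psi t N.-1).[node K N]) t 0 dsb (psic _ _ N1N).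
  rewrite mul0r; congr (is_derive _ _ _ _); apply/funext => s.
  by rewrite hornerD.
have da : is_derive t 1 (fun s => (sigma_a P s - sigma_a P t) *
    (right_lim K (psi s) 0 + right_lim K (psi t) 0)) 0.
  have := @is_derive_increment_mul R (sigma_a P)
    (fun s => (psi s 0%N + psi t 0%N).[node K 0]) t 0 dsa (psic _ _ N0).
  rewrite mul0r; congr (is_derive _ _ _ _); apply/funext => s.
  by rewrite hornerD.
have D := is_deriveD (is_derive_cst (electrostatic t) t (1 : R))
  (is_deriveD dG (is_deriveB db da)).
have -> : \sum_(0 <= j < N) \sum_(i < m) Defs.charge P i *
      cellint K j (fun x => dt (c i) t j x * (psi t j + psi t j).[x]) =
  0 + (\sum_(0 <= j < N) \sum_(i < m) Defs.charge P i *
      cellint K j (fun x => dt (c i) t j x * (psi t j + psi t j).[x]) + (0 - 0)).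
  by rewrite subrr addr0 add0r.
apply: near_eq_is_derive D; near=> s.
have [s0 sT] : 0 < s /\ (s%:E < T)%E by near: s; exact: near_lt_ereal.
rewrite !fctE /= -[RHS](subrK (electrostatic t)) electrostatic_sub// addrC.
by [].
Unshelve. all: by end_near. Qed.
End Solution.

Section Energy.
Context (R : realType) (a b : R) (hab : a < b) (N : nat) (K : mesh a b N)
  (k m : nat) (P : pnp_data R m) (Bp Bpsi : fluxpar R) (T : \bar R)
  (c p : 'I_m -> R -> pwpoly R) (psi : R -> pwpoly R).
Context (adm : admissible_data a b P) (sol : dg_solution K k P Bp Bpsi c p psi T)
  (pos : positive_conc K c T).

Lemma integrable_c_ln_c i j s : 0 < s -> (s%:E < T)%E -> (j < N)%N ->
  integrable_oo (node K j) (node K j.+1) (fun x => ln (c i s j).[x]).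
Proof.
move=> s0 sT jN; apply: integrable_ln_horner => x xj; apply: (pos s0 sT) => //.
by rewrite inE /cell /= in_itv.
Qed.

Lemma free_energyE s : 0 < s -> (s%:E < T)%E ->
  free_energy K P c psi s =
  \sum_(0 <= j < N) \sum_(i < m)
    cellint K j (fun x => (c i s j).[x] * ln (c i s j).[x])
  + 2^-1 * electrostatic K P c psi s.
Proof.
move=> s0 sT; rewrite /free_energy /electrostatic [X in _ = _ + X]mulrDr.
rewrite [RHS]addrA; congr (_ + _).
rewrite mulr_sumr -big_split/=; apply: eq_big_nat => j /andP[_ jN].
rewrite /cellint /cell.
have ci i : integrable_oo (node K j) (node K j.+1)
    (fun x => (c i s j).[x] * ln (c i s j).[x]).
  have := integrable_mul_horner (c i s j) (integrable_c_ln_c i s0 sT jN).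
  by apply: eq_integrable_oo => x _; exact: mulrC.
have ri := integrable_chargedens_mul K c adm s (psi s j) jN.
rewrite -integral_oo_big// -integral_ooZl// -integral_ooD.
- by apply: eq_integral_oo => x _; rewrite mulrA.
- exact: integrable_oo_big.
- exact: integrable_ooZl.
Qed.

(** The entropy contributes the integral of [dt c_i * (p_i - q_i psi + 1)] and the electrostatic
    part that of [dt c_i * q_i psi]; the potential cancels, and the scheme is tested with [p_i] and
    [1]. *)
Lemma is_derive_free_energy t : 0 < t -> (t%:E < T)%E ->
  stationary_sigma P T -> beta1 Bpsi = 0 ->
  is_derive t 1 (free_energy K P c psi)
    (- \sum_(i < m) A_form K Bp (c i t) (p i t) (p i t)).
Proof.
move=> t0 tT st b1; have N0 : (0 < N)%N := mesh_gt0 K hab.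
pose al j := node K j; pose be j := node K j.+1.
(* By the equation for [p], [r] is the projection of [ln c_i] on the cell. *)
pose q i j s := c i s j; pose r i j s := p i s j - Defs.charge P i *: psi s j.
have dE i j : j \in index_iota 0 N ->
    is_derive t 1 (fun s => cellint K j (fun x => (c i s j).[x] * ln (c i s j).[x]))
      (cellint K j (fun x => dt (c i) t j x * ((r i j t).[x] + 1))).
  rewrite mem_index_iota => /andP[_ jN].
  apply: (@is_derive_entropy R (al j) (be j) k (q i j) (r i j) t).
  - exact: (size_c_near sol).
  - near=> s; rewrite (leq_trans (size_polyD _ _))// size_polyN geq_max.
    apply/andP; split; first by near: s; exact: (size_p_near sol).
    rewrite (leq_trans (size_scale_leq _ _))//.
    by near: s; exact: (size_psi_near sol).
  - by move=> x; exact: (sol_c_derivable sol).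
  - move=> x; have -> : (fun s => (r i j s).[x]) =
        (fun s => (p i s j).[x] - Defs.charge P i * (psi s j).[x]).
      by apply/funext => s; rewrite /r !hornerE.
    apply: cvgB; first exact: (sol_p_continuous sol).
    by apply: cvgMr; exact: (sol_psi_continuous sol).
  - near=> s; have [s0 sT] : 0 < s /\ (s%:E < T)%E.
      by near: s; exact: near_lt_ereal.
    move=> x xj; apply: (pos s0 sT) => //.
    by rewrite inE /cell /= in_itv.
  - near=> s; have [s0 sT] : 0 < s /\ (s%:E < T)%E.
      by near: s; exact: near_lt_ereal.
    move=> f fk; have [_ sp _] := sol_scheme sol s0 sT.
    have := sp i (fun=> f) (Vh_const N fk) j jN; rewrite /cellint /cell => E.
    have Hi (u v : {poly R}) : integrable_oo (node K j) (node K j.+1)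
        (fun x => u.[x] * v.[x]).
      have := horner_integrable (node K j) (node K j.+1) (u * v).
      by apply: eq_integrable_oo => x _; rewrite hornerM.
    have psi_i : integrable_oo (node K j) (node K j.+1)
        (fun x => Defs.charge P i * ((psi s j).[x] * f.[x])).
      by apply: integrable_ooZl; exact: Hi.
    have ln_i : integrable_oo (node K j) (node K j.+1)
        (fun x => ln (c i s j).[x] * f.[x]).
      by apply: integrable_mul_horner; exact: integrable_c_ln_c.
    transitivity (integral_oo (al j) (be j) (fun x => (p i s j).[x] * f.[x]) -
      integral_oo (al j) (be j)
        (fun x => Defs.charge P i * ((psi s j).[x] * f.[x]))).
      rewrite -integral_ooB; [|exact: Hi|exact: psi_i].
      by apply: eq_integral_oo => x _; rewrite /r hornerD hornerN hornerZ; ring.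
    apply/eqP; rewrite subr_eq; apply/eqP; rewrite /al /be E.
    rewrite -integral_ooD; [|exact: ln_i|exact: psi_i].
    by apply: eq_integral_oo => x _; ring.
have dW := is_derive_electrostatic hab adm sol t0 tT st b1.
have D := is_deriveD (is_derive_big (fun j jN => is_derive_big
  (fun i (_ : i \in index_enum 'I_m) => dE i j jN))) (is_derive_cstMl 2^-1 dW).
apply: (@near_eq_is_derive _ _ _ _ _ _ _ _ _ (is_derive_eq D _)).
  near=> s; have [s0 sT] : 0 < s /\ (s%:E < T)%E.
    by near: s; exact: near_lt_ereal.
  by rewrite free_energyE.
have [scc _ _] := sol_scheme sol t0 tT.
have [_ pV _] := sol_Vh sol t0 tT.
have one : (fun=> 1%:P) \in @Vh R N k.
  by apply: Vh_const; rewrite (leq_trans (size_polyC_leq1 _)).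
transitivity (\sum_(i < m) (\sum_(0 <= j < N)
    cellint K j (fun x => dt (c i) t j x * (p i t j).[x]) +
  \sum_(0 <= j < N) cellint K j (fun x => dt (c i) t j x * (1%:P : {poly R}).[x]))).
  rewrite mulr_sumr -big_split/=.
  under [RHS]eq_bigr do rewrite -big_split/=.
  rewrite [RHS]exchange_big/=; apply: eq_big_nat => j /andP[_ jN].
  rewrite mulr_sumr -big_split/=; apply: eq_bigr => i _.
  have [Q _ QE] := dt_c_poly sol t0 tT i jN.
  have Hi (v : {poly R}) : integrable_oo (node K j) (node K j.+1)
      (fun x => dt (c i) t j x * v.[x]).
    have := horner_integrable (node K j) (node K j.+1) (Q * v).
    by apply: eq_integrable_oo => x _; rewrite hornerM QE.
  rewrite /cellint /cell -!integral_ooZl//; last exact: integrable_ooZl.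
  have ri : integrable_oo (node K j) (node K j.+1)
      (fun x => dt (c i) t j x * ((r i j t).[x] + 1)).
    have := Hi (r i j t + 1).
    by apply: eq_integrable_oo => x _; rewrite !hornerE.
  rewrite -!integral_ooD//; last by do 2 apply: integrable_ooZl.
  apply: eq_integral_oo => x _.
  by rewrite /r !hornerD hornerN hornerZ hornerC; field.
rewrite -sumrN; apply: eq_bigr => i _.
by rewrite !(scheme_c_sum i N0 _ scc)// A_form_const oppr0 addr0.
Unshelve. all: by end_near. Qed.

End Energy.

(** * Coercivity *)

(** There are finitely many cells, so the smallest of the cell constants serves for all; it is built
    by induction on the number of cells treated. *)
Lemma uniform_trace_bounds (R : realType) (a b : R) (N : nat) (K : mesh a b N)
    (n : nat) :
  exists2 kappa : R, 0 < kappa & forall j, (j < N)%N ->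
  forall (f g : {poly R}) (z : R),
    (size f <= n.+1)%N -> (size g <= n.+1)%N ->
    (forall x, x \in cell K j -> 0 <= f.[x]) ->
    z \in [:: node K j; node K j.+1] ->
    let mass := cellint K j (fun x => f.[x]) in
    let w := cellint K j (fun x => f.[x] * g.[x] * g.[x]) in
    [/\ kappa * f.[z] <= mass, kappa * mass * g.[z] ^+ 2 <= w
      & kappa * mass * g^`().[z] ^+ 2 <= w].
Proof.
suff H M : (M <= N)%N -> exists2 kappa : R, 0 < kappa & forall j, (j < M)%N ->
  forall (f g : {poly R}) (z : R),
    (size f <= n.+1)%N -> (size g <= n.+1)%N ->
    (forall x, x \in cell K j -> 0 <= f.[x]) ->
    z \in [:: node K j; node K j.+1] ->
    let mass := cellint K j (fun x => f.[x]) in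
    let w := cellint K j (fun x => f.[x] * g.[x] * g.[x]) in
    [/\ kappa * f.[z] <= mass, kappa * mass * g.[z] ^+ 2 <= w
      & kappa * mass * g^`().[z] ^+ 2 <= w].
  exact: H.
elim: M => [_|M IH MN]; first by exists 1.
have [k1 k10 H1] := IH (ltnW MN).
have [k2 k20 H2] := cell_trace_bounds n (node_incr K MN).
exists (Num.min k1 k2); first by rewrite lt_min k10.
move=> j; rewrite ltnS leq_eqVlt => jM f g z fn gn f0 zj mass w.
have f0' x : node K j < x < node K j.+1 -> 0 <= f.[x].
  by move=> xj; apply: f0; rewrite inE /cell /= in_itv.
have fz : 0 <= f.[z].
  have jN : (j < N)%N by rewrite (leq_trans _ MN)// ltnS leq_eqVlt.
  apply: (horner_ge0_itvcc (node_incr K jN) f0').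
  move: zj; rewrite !inE => /orP[]/eqP->; rewrite lexx ?andbT/= ltW//;
    exact: node_incr.
have mass0 : 0 <= mass.
  by apply: Rintegral_ge0 => x xj; apply: f0; exact: mem_set.
have weaken k3 : Num.min k1 k2 <= k3 ->
    [/\ k3 * f.[z] <= mass, k3 * mass * g.[z] ^+ 2 <= w
      & k3 * mass * g^`().[z] ^+ 2 <= w] ->
    [/\ Num.min k1 k2 * f.[z] <= mass, Num.min k1 k2 * mass * g.[z] ^+ 2 <= w
      & Num.min k1 k2 * mass * g^`().[z] ^+ 2 <= w].
  move=> k3m [h1 h2 h3].
  split; [apply: le_trans h1|apply: le_trans h2|apply: le_trans h3].
  - exact: ler_wpM2r.
  - by apply: ler_wpM2r; [exact: sqr_ge0|exact: ler_wpM2r].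
  - by apply: ler_wpM2r; [exact: sqr_ge0|exact: ler_wpM2r].
case/orP: jM => [/eqP jM|jM]; last first.
  by apply: (weaken k1); [rewrite ge_min lexx|exact: H1].
by apply: (weaken k2); [rewrite ge_min lexx orbT|subst j; exact: H2].
Qed.

(** Each cell touches at most two interior interfaces and gives half of [G] to each. *)
Lemma sum_adjacent_le (R : realType) (N : nat) (G : nat -> R) :
  (forall j, (j < N)%N -> 0 <= G j) ->
  \sum_(1 <= e < N) (2^-1 * (G e.-1 + G e)) <= \sum_(0 <= j < N) G j.
Proof.
case: N => [|n] G0; first by rewrite !big_geq.
rewrite -mulr_sumr big_split/= big_add1/=.
have E1 : \sum_(0 <= j < n.+1) G j = \sum_(0 <= i < n) G i + G n.
  by rewrite big_nat_recr.
have E2 : \sum_(0 <= j < n.+1) G j = G 0%N + \sum_(1 <= i < n.+1) G i.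
  by rewrite big_ltn.
by have := G0 0%N isT; have := G0 n (ltnSn n); lra.
Qed.

(** Completing the square in the jump bounds each interface term below by a multiple of the squared
    traces of [p'] and [p'']. The bound [lo] turns these traces into the volume terms [G] of the two
    adjacent cells, and [hi] bounds the average of [c]; a large [b0] makes the loss at most half of
    [G] from each side. *)
Lemma A_form_ge0 (R : realType) (a b : R) (N : nat) (K : mesh a b N) (k : nat)
    (b1 lo hi : R) : 0 < lo -> exists bmin : R, forall b0 : R, bmin <= b0 ->
  forall c p : pwpoly R, c \in Vh N k -> p \in Vh N k ->
  (forall j x, (j < N)%N -> x \in cell K j -> 0 < (c j).[x]) ->
  (forall j, (j < N)%N -> lo <= cellint K j (fun x => (c j).[x]) <= hi) ->
  0 <= A_form K (FluxPar b0 b1) c p p.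
Proof.
move=> lo0; have [kap kap0 HK] := uniform_trace_bounds K k.
pose h := hlen K; have h0 : 0 < h := hlen_gt0 K.
pose V := 4 * (1 + (b1 * h) ^+ 2) / (kap * lo).
have V0 : 0 < V by rewrite divr_gt0 ?mulr_gt0// ltr_pwDl// sqr_ge0.
(* Bounds the traces of [c]; the absolute value makes it nonnegative for any [hi]. *)
pose H := `|hi| / kap.
have H0 : 0 <= H by rewrite divr_ge0// ltW.
(* The threshold gives both [0 < b0] and [H h V <= b0], so the loss factor [H h V / (4 b0)] is at
   most [1/4]. *)
exists (1 + H * h * V) => b0 b0min c p cV pV cpos mass.
have b0pos : 0 < b0.
  apply: lt_le_trans b0min; rewrite ltr_pwDl//.
  by apply: mulr_ge0; [apply: mulr_ge0 => //|]; exact: ltW.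
pose G j := cellint K j (fun x =>
  (c j).[x] * (pwderiv p j).[x] * (pwderiv p j).[x]).
have sz j : (j < N)%N -> (size (pwderiv p j) <= k.+1)%N.
  move=> jN; rewrite /pwderiv (leq_trans (size_poly _ _))//.
  by rewrite (leq_trans (leq_pred _))// (VhP pV).
have trace j z : (j < N)%N -> z \in [:: node K j; node K j.+1] ->
    [/\ 0 <= (c j).[z], (c j).[z] <= H, kap * lo * (pwderiv p j).[z] ^+ 2 <= G j
      & kap * lo * (pwderiv (pwderiv p) j).[z] ^+ 2 <= G j].
  move=> jN zj; have c0 x : x \in cell K j -> 0 <= (c j).[x].
    by move=> xj; rewrite ltW// cpos.
  have [h1 h2 h3] := HK j jN (c j) (pwderiv p j) z (VhP cV jN) (sz j jN) c0 zj.
  have /andP[mlo mhi] := mass j jN.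
  have c0' x : node K j < x < node K j.+1 -> 0 <= (c j).[x].
    by move=> xj; apply: c0; rewrite inE /cell /= in_itv.
  split.
  - apply: (horner_ge0_itvcc (node_incr K jN) c0').
    move: zj; rewrite !inE => /orP[]/eqP->; rewrite lexx ?andbT/= ltW//;
      exact: node_incr.
  - rewrite /H ler_pdivlMr// mulrC (le_trans h1)// (le_trans mhi)//.
    exact: ler_norm.
  - apply: le_trans h2; apply: ler_wpM2r; first exact: sqr_ge0.
    by rewrite ler_pM2l.
  - apply: le_trans h3; apply: ler_wpM2r; first exact: sqr_ge0.
    by rewrite ler_pM2l.
have G0 j : (j < N)%N -> 0 <= G j.
  move=> jN; apply: Rintegral_ge0 => x xj; rewrite -mulrA -expr2.
  by rewrite mulr_ge0 ?sqr_ge0// ltW// cpos//; exact: mem_set.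
have interface e : (0 < e < N)%N -> - (2^-1 * (G e.-1 + G e)) <=
    avg K c e * (Fl K (FluxPar b0 b1) p e * jump K p e +
                 avg K (pwderiv p) e * jump K p e).
  move=> /andP[e0 eN].
  have eN0 : (e == 0%N) = false by rewrite gtn_eqF.
  have eNN : (e == N) = false by rewrite ltn_eqF.
  have [c1 c2 d1 d2] := trace e (node K e) eN (mem_head _ _).
  have e1N : (e.-1 < N)%N by rewrite (leq_ltn_trans (leq_pred _)).
  have ze : node K e \in [:: node K e.-1; node K e.-1.+1].
    by rewrite prednK// !inE eqxx orbT.
  have [c3 c4 d3 d4] := trace e.-1 (node K e) e1N ze.
  rewrite /Fl /= /avg eN0 eNN.
  rewrite {1}/right_lim {1}/left_lim.
  set J := jump K p e.
  set cr := (c e).[_] in c1 c2 *; set cl := (c e.-1).[_] in c3 c4 *.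
  rewrite /jump -/h.
  rewrite /right_lim /left_lim.
  set pr := (pwderiv p e).[_] in d1 *; set pl := (pwderiv p e.-1).[_] in d3 *.
  set qr := (pwderiv (pwderiv p) e).[_] in d2 *.
  set ql := (pwderiv (pwderiv p) e.-1).[_] in d4 *.
  (* The factor multiplying the jump besides the penalty: [{p'}] occurs once in [Fl] and once in the
     symmetrizing term, hence [2 {p'} = pr + pl]. *)
  pose X := pr + pl + b1 * h * (qr - ql).
  have X2 : X ^+ 2 <= V * (G e.-1 + G e).
    have klo : 0 < kap * lo by exact: mulr_gt0.
    rewrite /V mulrAC ler_pdivlMr// /X.
    move: d1 d2 d3 d4 klo; set w := kap * lo; set y := b1 * h.
    move=> d1 d2 d3 d4 klo.
    have y2 := sqr_ge0 y.
    have yd2 := ler_wpM2l y2 d2; have yd4 := ler_wpM2l y2 d4.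
    (* Cauchy-Schwarz for a sum of four terms: the defect is the sum of the squares of their
       pairwise differences. *)
    have cs : (pr + pl + y * (qr - ql)) ^+ 2 <=
        4 * (pr ^+ 2 + pl ^+ 2 + y ^+ 2 * (qr ^+ 2 + ql ^+ 2)).
      rewrite -subr_ge0.
      have -> : 4 * (pr ^+ 2 + pl ^+ 2 + y ^+ 2 * (qr ^+ 2 + ql ^+ 2))
        - (pr + pl + y * (qr - ql)) ^+ 2 =
        (pr - pl) ^+ 2 + (pr - y * qr) ^+ 2 + (pr + y * ql) ^+ 2
        + (pl - y * qr) ^+ 2 + (pl + y * ql) ^+ 2 + (y * qr + y * ql) ^+ 2 by ring.
      by rewrite !addr_ge0 ?sqr_ge0.
    have := ler_wpM2r (ltW klo) cs; lra.
  pose C := (cr + cl) / 2.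
  have C0 : 0 <= C by rewrite divr_ge0// addr_ge0.
  have CH : C <= H by rewrite /C ler_pdivrMr//; lra.
  have -> : (cr + cl) / 2 * ((b0 * (J / h) + (pr + pl) / 2 + b1 * h * (qr - ql)) * J
      + (pr + pl) / 2 * J) = C * (b0 * J ^+ 2 / h + X * J).
    by rewrite /C /X; field; rewrite gt_eqF.
  have sq : 0 <= b0 * J ^+ 2 / h + X * J + h / (4 * b0) * X ^+ 2.
    have -> : b0 * J ^+ 2 / h + X * J + h / (4 * b0) * X ^+ 2 =
       (h / (4 * b0)) * (2 * b0 * J / h + X) ^+ 2.
      by field; rewrite !gt_eqF.
    by rewrite mulr_ge0 ?sqr_ge0// divr_ge0 ?mulr_ge0// ltW.
  have GG : 0 <= G e.-1 + G e by rewrite addr_ge0// G0.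
  have : C * (h / (4 * b0) * X ^+ 2) <= 2^-1 * (G e.-1 + G e).
    apply: (@le_trans _ _ (H * (h / (4 * b0) * (V * (G e.-1 + G e))))).
      apply: ler_pM => //.
        by rewrite mulr_ge0 ?sqr_ge0// divr_ge0 ?mulr_ge0// ltW.
      by apply: ler_wpM2l => //; rewrite divr_ge0 ?mulr_ge0// ltW.
    have HhV : H * h * V <= b0 by lra.
    move: HhV GG; set S := G e.-1 + G e.
    clearbody V H h S; move=> HhV GG.
    have -> : H * (h / (4 * b0) * (V * S)) = H * h * V / (4 * b0) * S.
      by field; rewrite gt_eqF.
    apply: ler_wpM2r => //.
    by rewrite ler_pdivrMr ?mulr_gt0//; lra.
  have := mulr_ge0 C0 sq; rewrite mulrDr; lra.
rewrite /A_form -/G.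
have : \sum_(1 <= e < N) (2^-1 * (G e.-1 + G e)) <= \sum_(0 <= j < N) G j.
  exact: sum_adjacent_le.
have : \sum_(1 <= e < N) - (2^-1 * (G e.-1 + G e)) <= \sum_(1 <= e < N)
  avg K c e * (Fl K (FluxPar b0 b1) p e * jump K p e +
               avg K (pwderiv p) e * jump K p e).
  by rewrite !big_nat; apply: ler_sum => e; exact: interface.
rewrite sumrN => h1 h2.
rewrite -[X in X <= _](subrr (\sum_(0 <= j < N) G j)) lerD2l.
by rewrite (le_trans _ h1)// lerN2.
Qed.

Theorem theorem3p2 (R : realType) (a b : R) (hab : a < b) (N : nat)
    (K : mesh a b N) (k : nat) :
  (* conservation, and the energy identity *)
  (forall (m : nat) (P : pnp_data R m) (Bp Bpsi : fluxpar R) (T : \bar R)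
      (c p : 'I_m -> R -> pwpoly R) (psi : R -> pwpoly R),
    admissible_data a b P ->
    dg_solution K k P Bp Bpsi c p psi T ->
    (forall (i : 'I_m) (t : R), 0 < t -> (t%:E < T)%E ->
       is_derive t 1 (total_conc K c i) 0) /\
    (stationary_sigma P T -> positive_conc K c T -> beta1 Bpsi = 0 ->
     forall t : R, 0 < t -> (t%:E < T)%E ->
       is_derive t 1 (free_energy K P c psi)
         (- \sum_(i < m) A_form K Bp (c i t) (p i t) (p i t)))) /\
  (* energy dissipation: the threshold [bmin] for beta0 is fixed before the
     solution, given beta1 and bounds on the mass of c_i in each cell *)
  (forall b1 lo hi : R, 0 < lo -> exists bmin : R,
   forall b0 : R, bmin <= b0 ->
   forall (m : nat) (P : pnp_data R m) (Bpsi : fluxpar R) (T : \bar R)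
      (c p : 'I_m -> R -> pwpoly R) (psi : R -> pwpoly R),
    admissible_data a b P ->
    dg_solution K k P (FluxPar b0 b1) Bpsi c p psi T ->
    stationary_sigma P T -> positive_conc K c T -> beta1 Bpsi = 0 ->
    forall t : R, 0 < t -> (t%:E < T)%E ->
      (forall (i : 'I_m) (j : nat), (j < N)%N ->
         lo <= cellint K j (fun x => (c i t j).[x]) <= hi) ->
      derivable (free_energy K P c psi) t 1 /\
      'D_1 (free_energy K P c psi) t <= 0).
Proof.
split=> [m P Bp Bpsi T c p psi adm sol|b1 lo hi lo0].
  split=> [i t t0 tT|st pos b1 t t0 tT].
    exact: (is_derive_total_conc hab sol t0 tT).
  exact: (is_derive_free_energy hab adm sol pos t0 tT st b1).
(* The threshold is obtained from the mesh, the degree, [b1] and the mass bounds alone, so it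
   precedes the choice of the data and the solution. *)
have [bmin H] := A_form_ge0 K k b1 hi lo0.
exists bmin => b0 b0min m P Bpsi T c p psi adm sol st pos bpsi t t0 tT mass.
have D := is_derive_free_energy hab adm sol pos t0 tT st bpsi.
have [cV pV _] := sol_Vh sol t0 tT.
split; first exact: (@ex_derive _ _ _ _ _ _ _ D).
rewrite (@derive_val _ _ _ _ _ _ _ D) oppr_le0; apply: sumr_ge0 => i _.
apply: H => // [j x jN xj|j jN]; first exact: pos.
exact: mass.
Qed.
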